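(* Suppose every component $f_i:\mathbb{R}^d\to\mathbb{R}$ ($i=1,\dots,n$, $n\ge 2$) is differentiable with $L$-Lipschitz gradient, the average $F=\frac1n\sum_{i=1}^n f_i$ is $\mu$-strongly convex with $0<\mu\le L$ and unique minimizer $x_\star$, and $F$ is twice differentiable with $\|\nabla^2F(x)-\nabla^2F(y)\|_{\mathrm{op}}\le\rho\|x-y\|$ for all $x,y\in\mathbb{R}^d$. Let $K\ge 1$, $T=nK\ge3$, run random reshuffling with constant component stepsize $\eta=\frac{4\log T}{\mu T}$, and suppose $K\ge128\frac{L^2}{\mu^2}\log T$. Then $$ \mathbb{E}\|y_K-x_\star\|^2\le\frac{D^2}{T^2}+\frac{1024L^2G^2\log^2T}{\mu^4T^2}+\frac{384L^2G^2n^2\log^3T}{\mu^4T^3}+\frac{2048\rho^2G^4n^2\log^4T}{9\mu^6T^4}. $$ Consequently, $$ \mathbb{E}\bigl[F(y_K)-F(x_\star)\bigr]=\widetilde{\mathcal O}\left(\frac{1}{(nK)^2}+\frac{1}{nK^3}\right). $$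
   Context: Random reshuffling (RR) with constant component stepsize $\eta>0$ starts from a deterministic point $y_0\in\mathbb{R}^d$. At each epoch $k=0,1,\dots,K-1$ it draws a fresh, independent, uniformly random permutation $\pi_k$ of $\{1,\dots,n\}$, sets $x_{k,0}=y_k$, performs $x_{k,i}=x_{k,i-1}-\eta\nabla f_{\pi_k(i)}(x_{k,i-1})$ for $i=1,\dots,n$, and sets $y_{k+1}=x_{k,n}$. Expectations are over the permutations. Constants: $G_\star:=\max_{i}\|\nabla f_i(x_\star)\|$, $D:=\max\{\|y_0-x_\star\|,\,G_\star/(2L)\}$, $G:=G_\star+2LD$. The notation $\widetilde{\mathcal O}(\phi)$ means a bound $C(\log T)^p\phi$ with $p$ an absolute constant and $C$ depending only on the fixed problem parameters $L,\mu,\rho,G,D$ (not on $n,K$). *)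

(* Defs.v *)
From HB Require Import structures.
From mathcomp Require Import all_boot all_order all_algebra all_fingroup.
From mathcomp Require Import all_classical all_reals all_analysis.
Set Implicit Arguments.
Unset Strict Implicit.
Unset Printing Implicit Defensive.
Import Order.TTheory GRing.Theory Num.Theory numFieldNormedType.Exports.
Local Open Scope classical_set_scope.
Local Open Scope ring_scope.

(* [`|x|] on ['rV[R]_d] is the library's sup norm, which is used only through
   [differentiable] and the derivatives, where the choice of norm is immaterial.
   All quantitative hypotheses and bounds use the Euclidean norm [enorm]. *)
Definition enorm (R : realType) (d : nat) (x : 'rV[R]_d) : R :=
  Num.sqrt (\sum_(j < d) x 0 j ^+ 2).

Definition opnorm (R : realType) (d : nat) (A : 'M[R]_d) : R :=
  sup [set enorm (v *m A) | v in [set v : 'rV[R]_d | enorm v <= 1]].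

Definition grad (R : realType) (d : nat) (f : 'rV[R]_d -> R) (x : 'rV[R]_d) :
    'rV[R]_d :=
  \row_(j < d) 'D_(delta_mx 0 j) f x.

Definition hess (R : realType) (d : nat) (f : 'rV[R]_d -> R) (x : 'rV[R]_d) :
    'M[R]_d :=
  'J (grad f) x.

Definition twice_differentiable (R : realType) (d : nat) (f : 'rV[R]_d -> R) :=
  (forall x, differentiable f x) /\ (forall x, differentiable (grad f) x).

Definition strongly_convex (R : realType) (d : nat) (mu : R)
    (f : 'rV[R]_d -> R) :=
  forall (x y : 'rV[R]_d) (t : R), 0 <= t <= 1 ->
    f (t *: x + (1 - t) *: y) <=
      t * f x + (1 - t) * f y - mu / 2 * t * (1 - t) * enorm (x - y) ^+ 2.

Definition unique_minimizer (R : realType) (d : nat) (f : 'rV[R]_d -> R)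
    (xs : 'rV[R]_d) :=
  forall x, x != xs -> f xs < f x.

Section RandomReshuffling.
Context (R : realType) (d n : nat) (f : 'I_n -> 'rV[R]_d -> R).
Implicit Types (x y xs : 'rV[R]_d) (s : 'S_n) (L mu rho eta : R) (K : nat).

Definition average x : R := n%:R^-1 * \sum_(i < n) f i x.

(* [enum 'I_n] lists 0, ..., n-1 in order, so the components are visited in the
   order s 0, ..., s (n-1). *)
Definition rr_epoch eta y s : 'rV[R]_d :=
  foldl (fun x i => x - eta *: grad (f (s i)) x) y (enum 'I_n).

Definition rr_iterate eta y0 K (pi : K.-tuple 'S_n) : 'rV[R]_d :=
  foldl (rr_epoch eta) y0 pi.

Definition Gstar xs : R := \big[Num.max/0]_(i < n) enorm (grad (f i) xs).

Definition Dconst L xs y0 : R := Num.max (enorm (y0 - xs)) (Gstar xs / (2 * L)).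

Definition Gconst L xs y0 : R := Gstar xs + 2 * L * Dconst L xs y0.

Definition rr_stepsize mu K : R := 4 * ln (n * K)%:R / (mu * (n * K)%:R).

Record rr_setting L mu rho xs y0 K : Prop := RRSetting {
  rr_n_ge2 : (2 <= n)%N;
  rr_diff : forall i x, differentiable (f i) x;
  rr_smooth : forall i x y,
    enorm (grad (f i) x - grad (f i) y) <= L * enorm (x - y);
  rr_mu_gt0 : 0 < mu;
  rr_mu_leL : mu <= L;
  rr_strongly_convex : strongly_convex mu average;
  rr_minimizer : unique_minimizer average xs;
  rr_twice_diff : twice_differentiable average;
  rr_hess_lipschitz : forall x y,
    opnorm (hess average x - hess average y) <= rho * enorm (x - y);
  rr_K_ge1 : (1 <= K)%N;
  rr_T_ge3 : (3 <= n * K)%N;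
  rr_K_large : 128 * (L ^+ 2 / mu ^+ 2) * ln (n * K)%:R <= K%:R }.

End RandomReshuffling.

(* Expectation under the product over the K epochs of the uniform law on 'S_n,
   i.e. for K independent uniformly random permutations. *)
Definition rr_expectation (R : realType) (n K : nat)
    (phi : K.-tuple 'S_n -> R) : R :=
  \sum_(pi : K.-tuple 'S_n) (\prod_(k < K) (#|{: 'S_n}|%:R : R)^-1) * phi pi.

(* Main.v *)
Require Import Defs.
From HB Require Import structures.
From mathcomp Require Import all_boot all_order all_algebra all_fingroup.
From mathcomp Require Import all_classical all_reals all_analysis.
From mathcomp Require Import ring lra.
Set Implicit Arguments.
Unset Strict Implicit.
Unset Printing Implicit Defensive.
Import Order.TTheory GRing.Theory Num.Theory numFieldNormedType.Exports.
Local Open Scope classical_set_scope.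
Local Open Scope ring_scope.

(* Over one epoch from [y], compare the reshuffled path [x_k] with the gradient
   descent path [z_k] of the average [F] from the same point, both with the
   component stepsize eta; write delta_k = x_k - z_k.  Gradient descent
   contracts the squared distance to [xs] over the epoch.
   - Sampling without replacement gives E|delta_k|^2 = O(k eta^2 G^2).  Over a
     full epoch the component gradients at [y] sum to n grad F(y) whatever the
     permutation, so that E|delta_n|^2 is only O(n^3 eta^4 L^2 G^2).
   - For the bias |E delta_n|, exchanging two positions of the permutation shows
     that replacing the sampled component by [F] costs O(eta L G) per epoch
     step, and the Taylor expansion of grad F at the deterministic point [z_k]
     replaces E[grad F(x_k) - grad F(z_k)] by a linear image of E delta_k, up to
     rho E|delta_k|^2; hence
     |E delta_n| = O(n eta^2 L G + rho n^2 eta^3 G^2).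
   Absorbing the cross term 2 <z_n - xs, E delta_n> into the contraction by
   Young's inequality gives a recursion with factor 1 - n eta mu / 2, whose
   K-th power is at most exp(- 2 log T) = 1/T^2.  Almost surely all iterates stay
   in the ball of radius [D] (and [2 D] within epochs), where the component
   gradients are bounded by [G]. *)

(** * Euclidean geometry of row vectors *)

Section Euclidean.
Context (R : realType) (d : nat).
Implicit Types (u v w : 'rV[R]_d) (a : R).

Definition edot u v : R := \sum_(j < d) u 0 j * v 0 j.

Lemma edotC u v : edot u v = edot v u.
Proof. by apply: eq_bigr => j _; rewrite mulrC. Qed.

Lemma edotDl u v w : edot (u + v) w = edot u w + edot v w.
Proof. by rewrite -big_split; apply: eq_bigr => j _; rewrite mxE mulrDl. Qed.

Lemma edotZl a u v : edot (a *: u) v = a * edot u v.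
Proof. by rewrite /edot mulr_sumr; apply: eq_bigr => j _; rewrite mxE mulrA. Qed.

Lemma edotNl u v : edot (- u) v = - edot u v.
Proof. by rewrite -scaleN1r edotZl mulN1r. Qed.

Lemma edotDr u v w : edot u (v + w) = edot u v + edot u w.
Proof. by rewrite edotC edotDl !(edotC u). Qed.

Lemma edotZr a u v : edot u (a *: v) = a * edot u v.
Proof. by rewrite edotC edotZl edotC. Qed.

Lemma edotNr u v : edot u (- v) = - edot u v.
Proof. by rewrite edotC edotNl edotC. Qed.

Lemma edot0l u : edot 0 u = 0.
Proof. by rewrite -(scale0r 0) edotZl mul0r. Qed.

Lemma edot_suml I (s : seq I) (P : pred I) (F : I -> 'rV[R]_d) v :
  edot (\sum_(i <- s | P i) F i) v = \sum_(i <- s | P i) edot (F i) v.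
Proof.
by elim/big_rec2: _ => [|i x y _ <-]; rewrite ?edot0l // edotDl.
Qed.

Lemma edot_sumr I (s : seq I) (P : pred I) (F : I -> 'rV[R]_d) v :
  edot v (\sum_(i <- s | P i) F i) = \sum_(i <- s | P i) edot v (F i).
Proof. by rewrite edotC edot_suml; apply: eq_bigr => i _; rewrite edotC. Qed.

Lemma enorm_ge0 u : 0 <= enorm u. Proof. exact: sqrtr_ge0. Qed.

Lemma sqr_enorm u : enorm u ^+ 2 = edot u u.
Proof.
by rewrite sqr_sqrtr ?sumr_ge0 // => j _; exact: sqr_ge0.
Qed.

Lemma enorm0_eq0 u : enorm u = 0 -> u = 0.
Proof.
move=> u0; have : enorm u ^+ 2 = 0 by rewrite u0 expr0n.
rewrite sqr_enorm => /eqP; rewrite psumr_eq0 => [/allP h|j _]; last first.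
  by rewrite -expr2 sqr_ge0.
apply/rowP => j; have := h j; rewrite mem_index_enum => /(_ isT) /=.
by rewrite mxE mulf_eq0 orbb => /eqP.
Qed.

Lemma sqr_enormD u v :
  enorm (u + v) ^+ 2 = enorm u ^+ 2 + 2 * edot u v + enorm v ^+ 2.
Proof. by rewrite !sqr_enorm edotDl !edotDr (edotC v u); ring. Qed.

Lemma sqr_enormB u v :
  enorm (u - v) ^+ 2 = enorm u ^+ 2 - 2 * edot u v + enorm v ^+ 2.
Proof.
by rewrite !sqr_enorm edotDl !edotDr !edotNl !edotNr (edotC v u); ring.
Qed.

Lemma enormZ a u : enorm (a *: u) = `|a| * enorm u.
Proof.
apply/eqP; rewrite -(@eqrXn2 _ 2) ?enorm_ge0 ?mulr_ge0 ?enorm_ge0 //.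
by rewrite exprMn !sqr_enorm edotZl edotZr mulrA -expr2 real_normK ?num_real.
Qed.

Lemma enormN u : enorm (- u) = enorm u.
Proof. by rewrite -scaleN1r enormZ normrN1 mul1r. Qed.

Lemma enorm0 : enorm (0 : 'rV[R]_d) = 0.
Proof. by rewrite -(scale0r 0) enormZ normr0 mul0r. Qed.

Lemma edot_le u v : edot u v <= enorm u * enorm v.
Proof.
have [v0|vn0] := eqVneq (enorm v) 0.
  by rewrite v0 (enorm0_eq0 v0) edotC edot0l mulr0.
have [u0|un0] := eqVneq (enorm u) 0.
  by rewrite u0 (enorm0_eq0 u0) edot0l mul0r.
have up : 0 < enorm u by rewrite lt_def un0 enorm_ge0.
have vp : 0 < enorm v by rewrite lt_def vn0 enorm_ge0.
have := sqr_ge0 (enorm (enorm v *: u - enorm u *: v)).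
rewrite sqr_enormB !enormZ edotZl edotZr !ger0_norm ?enorm_ge0 // => h.
have {}h : 0 <= 2 * (enorm u * enorm v) * (enorm u * enorm v - edot u v) by nra.
by rewrite -subr_ge0 -(pmulr_rge0 _ (_ : 0 < 2 * (enorm u * enorm v))) // !mulr_gt0.
Qed.

Lemma enormD_le u v : enorm (u + v) <= enorm u + enorm v.
Proof.
rewrite -(@ler_pXn2r _ 2) ?nnegrE ?addr_ge0 ?enorm_ge0 // sqr_enormD.
by have := edot_le u v; nra.
Qed.

Lemma enormB_le u v : enorm (u - v) <= enorm u + enorm v.
Proof. by rewrite -(enormN v) enormD_le. Qed.

Lemma enorm_dist_triangle v u w : enorm (u - w) <= enorm (u - v) + enorm (v - w).
Proof. by apply: le_trans (enormD_le _ _); rewrite addrA subrK. Qed.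

Lemma enorm_sum_le I (s : seq I) (P : pred I) (F : I -> 'rV[R]_d) :
  enorm (\sum_(i <- s | P i) F i) <= \sum_(i <- s | P i) enorm (F i).
Proof.
elim/big_rec2: _ => [|i x y _ h]; first by rewrite enorm0.
by apply: le_trans (enormD_le _ _) _; rewrite lerD2l.
Qed.

Lemma sqr_enormD_le c u v : 0 < c ->
  enorm (u + v) ^+ 2 <= (1 + c) * enorm u ^+ 2 + (1 + c^-1) * enorm v ^+ 2.
Proof.
move=> c0; rewrite sqr_enormD.
have := sqr_ge0 (enorm (c *: u - v)); rewrite sqr_enormB edotZl enormZ exprMn.
rewrite real_normK ?num_real // => h.
have -> : (1 + c) * enorm u ^+ 2 + (1 + c^-1) * enorm v ^+ 2 =
  enorm u ^+ 2 + enorm v ^+ 2 + c^-1 * (c ^+ 2 * enorm u ^+ 2 + enorm v ^+ 2).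
  by field; rewrite gt_eqF.
have : 2 * edot u v <= c^-1 * (c ^+ 2 * enorm u ^+ 2 + enorm v ^+ 2).
  by rewrite ler_pdivlMl //; lra.
lra.
Qed.

Lemma sqr_enorm_sum_le (I : finType) (P : pred I) (F : I -> 'rV[R]_d) :
  enorm (\sum_(i | P i) F i) ^+ 2 <=
  #|P|%:R * \sum_(i | P i) enorm (F i) ^+ 2.
Proof.
rewrite sqr_enorm edot_suml.
under eq_bigr do rewrite edot_sumr.
have -> : #|P|%:R * \sum_(i | P i) enorm (F i) ^+ 2 =
  \sum_(i | P i) \sum_(j | P j) (2^-1 * (enorm (F i) ^+ 2 + enorm (F j) ^+ 2)).
  under [RHS]eq_bigr do rewrite -mulr_sumr big_split sumr_const -mulr_natl /=.
  rewrite -mulr_sumr big_split sumr_const /=.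
  by rewrite sumrMnl -mulr2n -[(_ *+ #|P|) *+ 2]mulr_natl -(mulr_natl _ #|P|); field.
apply: ler_sum => i _; apply: ler_sum => j _.
by have := sqr_ge0 (enorm (F i - F j)); rewrite sqr_enormB; lra.
Qed.

(** Taking [u := v] suffices. This duality reduces estimates of vector-valued maps to calculus of
    real functions. *)
Lemma enorm_le_edot_bound v (c : R) : 0 <= c ->
  (forall u, edot u v <= c * enorm u) -> enorm v <= c.
Proof.
move=> c0 /(_ v); rewrite -sqr_enorm expr2.
have [->//|vn0] := eqVneq (enorm v) 0.
by rewrite ler_pM2r // lt_def vn0 enorm_ge0.
Qed.

End Euclidean.

(** * Gradients and Hessians *)

Section Calculus.
Context (R : realType) (d : nat).
Implicit Types (F : 'rV[R]_d -> R) (x y z u v : 'rV[R]_d).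

Lemma derive_grad F x v : differentiable F x -> 'D_v F x = edot v (grad F x).
Proof.
move=> dF; rewrite deriveE // {1}(row_sum_delta v) linear_sum.
by apply: eq_bigr => j _; rewrite linearZ /= -deriveE // mxE.
Qed.

(** The difference quotient is at most [A + B * t] for small positive [t], and only the limit from
    the right is taken. The slot [B] absorbs second-order terms. *)
Lemma derive_le F x v (A B : R) : derivable F x v ->
  (forall t, 0 < t -> t <= 1 -> F (x + t *: v) - F x <= t * (A + B * t)) ->
  'D_v F x <= A.
Proof.
move=> dF h; have c1 := cvg_dnbhs_at_right dF.
have c2 : (A + B * t) @[t --> (0:R)^'+] --> A.
  rewrite -[X in _ --> X]addr0 -[X in _ + X](mulr0 B).
  apply: cvgD; first exact: cvg_cst.
  by apply: cvgM; [exact: cvg_cst | exact/cvg_at_right_filter/cvg_id].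
apply: ler_cvg_to c1 c2 _; near=> t.
have t0 : 0 < t by near: t; exact: nbhs_right_gt.
have t1 : t <= 1 by near: t; apply: nbhs_right_le.
by rewrite /= [_ + x]addrC /GRing.scale /= ler_pdivrMl // h.
Unshelve. all: by end_near. Qed.

Lemma strongly_convex_grad (mu : R) F x y :
  strongly_convex mu F -> differentiable F x ->
  edot (y - x) (grad F x) <= F y - F x - mu / 2 * enorm (y - x) ^+ 2.
Proof.
move=> sc dF; rewrite -derive_grad //.
(* The factor [1 - t] of the convexity gap splits into the limit term and an error linear in [t],
   which is the [B] passed here. *)
apply: (@derive_le _ _ _ _ (mu / 2 * enorm (y - x) ^+ 2)).
  exact: diff_derivable.
move=> t t0 t1; have := sc y x t; rewrite (ltW t0) t1 => /(_ isT).
have -> : t *: y + (1 - t) *: x = x + t *: (y - x).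
  by rewrite scalerBl scale1r scalerBr addrCA addrC -addrA [- _ + _]addrC.
by move=> h; nra.
Qed.

Lemma grad_minimizer F x :
  differentiable F x -> unique_minimizer F x -> grad F x = 0.
Proof.
move=> dF um; apply: enorm0_eq0; apply/eqP.
have dv v : derivable F x v by exact: diff_derivable.
(* Along [- grad F x] the derivative of [- F] is the squared norm of the gradient, while minimality
   makes it nonpositive. *)
have : 'D_(- grad F x) (- F) x <= 0.
  apply: (@derive_le _ _ _ _ 0); first exact: derivableN.
  move=> t _ _; rewrite mul0r addr0 mulr0 /GRing.opp /= /GRing.opp /=.
  rewrite -opprD oppr_le0 subr_ge0.
  by have [->//|/um/ltW] := eqVneq (x + t *: - grad F x) x.
rewrite deriveN // derive_grad // edotNl opprK -sqr_enorm => h.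
by rewrite -sqrf_eq0 eq_le h sqr_ge0.
Qed.

Lemma is_derive_quadratic (a b t : R) :
  is_derive t 1 (fun s : R => a * s + b * s ^+ 2) (a + 2 * b * t).
Proof.
have h := is_derive_poly (a *: 'X + b *: 'X^2) t.
rewrite derivD !derivZ derivX derivXn in h.
rewrite (_ : (fun s => _) = horner (a *: 'X + b *: 'X^2)); last first.
  by apply/funext => s; rewrite !hornerE.
rewrite (_ : a + _ = (a *: 1 + b *: ('X *+ 2)).[t]); first exact: h.
by rewrite !hornerE; ring.
Qed.

Lemma is_derive_line F z v (t : R) : differentiable F (z + t *: v) ->
  is_derive t 1 (fun s : R => F (z + s *: v)) ('D_v F (z + t *: v)).
Proof.
move=> dF; have c : derivable F (z + t *: v) v by exact: diff_derivable.
have E : (fun h : R => h^-1 *: (((fun s : R => F (z + s *: v)) \o shift t) (h *: 1)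
            - F (z + t *: v))) =
   (fun h : R => h^-1 *: ((F \o shift (z + t *: v)) (h *: v) - F (z + t *: v))).
  apply/funext => h /=; congr (_ *: (F _ - _)).
  by rewrite [h *: 1]mulr1 scalerDl addrCA.
by split; rewrite /derivable /derive E.
Qed.

Lemma derive_edot (g : 'rV[R]_d -> 'rV[R]_d) u x v : differentiable g x ->
  differentiable (fun y => edot u (g y)) x /\
  'D_v (fun y => edot u (g y)) x = edot u (v *m 'J g x).
Proof.
move=> dg.
have dj j : differentiable (fun y => g y 0 j) x.
  exact: (differentiable_comp dg (differentiable_coord _ _ _)).
have E : (fun y => edot u (g y)) = \sum_(j < d) (u 0 j \*: (fun y => g y 0 j)).
  by apply/funext => y; rewrite fct_sumE.
split.
  rewrite E; apply: differentiable_sum => j; exact: differentiableZ.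
rewrite E derive_sum => [|j]; last first.
  by apply: derivableZ; exact: diff_derivable.
rewrite -deriveEjacobian // derive_mx; last exact: diff_derivable.
apply: eq_bigr => j _; rewrite deriveZ ?mxE //; exact: diff_derivable.
Qed.

(** * Jacobian of a Lipschitz map and its first-order Taylor remainder *)

Section Smooth.
Context (g : 'rV[R]_d -> 'rV[R]_d) (L : R).
Hypothesis L_ge0 : 0 <= L.
Hypothesis dg : forall x, differentiable g x.
Hypothesis g_lip : forall x y, enorm (g x - g y) <= L * enorm (x - y).

Lemma jacobian_bound x v : enorm (v *m 'J g x) <= L * enorm v.
Proof.
apply: enorm_le_edot_bound => [|u]; first by rewrite mulr_ge0 ?enorm_ge0.
have [dG <-] := derive_edot u v (dg x).
apply: (@derive_le _ _ _ _ 0); first exact: diff_derivable.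
move=> t t0 _; rewrite -edotNr -edotDr; apply: le_trans (edot_le _ _) _.
have := g_lip (x + t *: v) x; rewrite [x + _]addrC addrK enormZ gtr0_norm //.
by have := enorm_ge0 u; nra.
Qed.

(** [opnorm] is a [sup], so it dominates its set only once that set is known to be bounded; [M]
    supplies this bound and does not enter the conclusion. *)
Lemma mulmx_le_opnorm (A : 'M[R]_d) (M : R) v :
  (forall w, enorm (w *m A) <= M * enorm w) ->
  enorm (v *m A) <= opnorm A * enorm v.
Proof.
move=> hM; have [v0|vn0] := eqVneq (enorm v) 0.
  by rewrite v0 mulr0 (enorm0_eq0 v0) mul0mx enorm0.
have vp : 0 < enorm v by rewrite lt_def vn0 enorm_ge0.
rewrite -ler_pdivrMr // -[_ / _]mulrC.
have -> : (enorm v)^-1 * enorm (v *m A) = enorm (((enorm v)^-1 *: v) *m A).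
  by rewrite -scalemxAl enormZ gtr0_norm ?invr_gt0.
apply: ub_le_sup; last first.
  by exists ((enorm v)^-1 *: v) => //=; rewrite enormZ gtr0_norm ?invr_gt0 // mulVf.
exists `|M| => _ [w /= w1 <-]; apply: le_trans (hM w) _.
apply: le_trans (ler_wpM2r (enorm_ge0 w) (ler_norm M)) _.
by rewrite ler_piMr.
Qed.

(** Tested against [u] on the segment from [z] to [x], the remainder minus its quadratic majorant
    has nonpositive derivative, so the mean value theorem concludes. The absolute value keeps the
    majorant nonnegative when the sign of [rho] is unknown. *)
Lemma jacobian_taylor (rho : R) x z :
  (forall x y, opnorm ('J g x - 'J g y) <= rho * enorm (x - y)) ->
  enorm (g x - g z - (x - z) *m 'J g z) <= `|rho| / 2 * enorm (x - z) ^+ 2.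
Proof.
move=> Hlip.
apply: enorm_le_edot_bound => [|u]; first by rewrite mulr_ge0 ?sqr_ge0 ?divr_ge0.
set v := x - z.
pose c : R := `|rho| * enorm v ^+ 2 * enorm u.
pose G := fun y => edot u (g y).
pose a := edot u (v *m 'J g z).
pose phi := (fun t : R => G (z + t *: v)) - (fun t : R => a * t + c / 2 * t ^+ 2).
have dG y : differentiable G y by exact: (derive_edot u v (dg y)).1.
pose dphi t := edot u (v *m 'J g (z + t *: v)) - (a + 2 * (c / 2) * t).
have dph (t : R) : is_derive t 1 phi (dphi t).
  have hl := @is_derive_line G z v t (dG _).
  have := (derive_edot u v (dg (z + t *: v))).2; rewrite -/G => hE.
  rewrite hE in hl.
  exact: (is_deriveB hl (is_derive_quadratic _ _ _)).
have [|s sI] := @MVT R phi dphi 0 1 ltr01 (fun t _ => dph t).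
  by apply: derivable_within_continuous => t _; exact: (@ex_derive _ _ _ _ _ _ _ (dph t)).
have s0 : 0 < s by move: sI; rewrite in_itv /= => /andP[].
rewrite subr0 mulr1 => hs.
have : dphi s <= 0.
  rewrite /dphi opprD addrA -edotNr -edotDr -mulmxN -mulmxDr subr_le0.
  apply: le_trans (edot_le _ _) _.
  (* This crude bound only gives access to [opnorm]; the quantitative estimate comes from [Hlip]. *)
  have hA w : enorm (w *m ('J g (z + s *: v) - 'J g z)) <= (L + L) * enorm w.
    by rewrite mulmxBr; apply: le_trans (enormB_le _ _) _; rewrite mulrDl lerD ?jacobian_bound.
  have := mulmx_le_opnorm v hA; have := Hlip (z + s *: v) z.
  rewrite [z + _]addrC addrK enormZ gtr0_norm // /c => h1 h2.
  have h3 : rho * (s * enorm v) <= `|rho| * (s * enorm v).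
    by rewrite ler_wpM2r ?ler_norm // mulr_ge0 ?enorm_ge0 // ltW.
  have h4 := le_trans h2 (ler_wpM2r (enorm_ge0 v) (le_trans h1 h3)).
  have := ler_wpM2l (enorm_ge0 u) h4; lra.
have ph1 : phi 1 = G x - (a * 1 + c / 2 * 1 ^+ 2).
  by rewrite /phi /v -[LHS]/(G _ - _) scale1r [z + _]addrC subrK.
have ph0 : phi 0 = G z - (a * 0 + c / 2 * 0 ^+ 2).
  by rewrite /phi -[LHS]/(G _ - _) scale0r addr0.
rewrite -hs ph1 ph0 !edotDr !edotNr -/a /G /c expr0n expr1n /= => h; lra.
Qed.

End Smooth.

Lemma grad_average n (f : 'I_n -> 'rV[R]_d -> R) x :
  (forall i x, differentiable (f i) x) ->
  grad (average f) x = n%:R^-1 *: \sum_(i < n) grad (f i) x.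
Proof.
move=> df; apply/rowP => j; rewrite !mxE summxE.
have -> : average f = n%:R^-1 \*: \sum_(i < n) f i.
  by apply/funext => y; rewrite fct_sumE.
have dj i : derivable (f i) x (delta_mx 0 j) by exact: diff_derivable.
rewrite deriveZ; last exact: derivable_sum.
by rewrite derive_sum //; congr (_ * _); apply: eq_bigr => i _; rewrite mxE.
Qed.

End Calculus.

(** * Averages and uniform permutations *)

Section Mean.
Context (R : realType) (T : finType).
Implicit Types (phi psi : T -> R).

Definition mean phi : R := #|T|%:R^-1 * \sum_t phi t.

Lemma eq_mean phi psi : phi =1 psi -> mean phi = mean psi.
Proof. by move=> e; rewrite /mean (eq_bigr _ (fun t _ => e t)). Qed.

Lemma le_mean phi psi : (forall t, phi t <= psi t) -> mean phi <= mean psi.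
Proof. by move=> e; rewrite ler_wpM2l ?invr_ge0 // ler_sum. Qed.

Lemma mean_ge0 phi : (forall t, 0 <= phi t) -> 0 <= mean phi.
Proof. by move=> e; rewrite mulr_ge0 ?invr_ge0 // sumr_ge0. Qed.

Lemma meanD phi psi : mean (fun t => phi t + psi t) = mean phi + mean psi.
Proof. by rewrite /mean big_split mulrDr. Qed.

Lemma meanZ (a : R) phi : mean (fun t => a * phi t) = a * mean phi.
Proof. by rewrite /mean -mulr_sumr mulrCA. Qed.

Lemma mean_sum (I : finType) (P : pred I) (phi : I -> T -> R) :
  mean (fun t => \sum_(i | P i) phi i t) = \sum_(i | P i) mean (phi i).
Proof. by rewrite /mean exchange_big -mulr_sumr. Qed.

Lemma mean_cst (a : R) : (0 < #|T|)%N -> mean (fun=> a) = a.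
Proof.
by move=> T0; rewrite /mean sumr_const -[a *+ _]mulr_natl mulKf // pnatr_eq0 -lt0n.
Qed.

Section Vector.
Context (d : nat).
Implicit Types (F H : T -> 'rV[R]_d).

Definition vmean F : 'rV[R]_d := #|T|%:R^-1 *: \sum_t F t.

Lemma eq_vmean F H : F =1 H -> vmean F = vmean H.
Proof. by move=> e; rewrite /vmean (eq_bigr _ (fun t _ => e t)). Qed.

Lemma vmeanE F j : vmean F 0 j = mean (fun t => F t 0 j).
Proof. by rewrite /vmean mxE summxE. Qed.

Lemma vmeanD F H : vmean (fun t => F t + H t) = vmean F + vmean H.
Proof. by rewrite /vmean big_split scalerDr. Qed.

Lemma vmeanN F : vmean (fun t => - F t) = - vmean F.
Proof. by rewrite /vmean sumrN scalerN. Qed.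

Lemma vmeanB F H : vmean (fun t => F t - H t) = vmean F - vmean H.
Proof. by rewrite vmeanD vmeanN. Qed.

Lemma vmeanZ (a : R) F : vmean (fun t => a *: F t) = a *: vmean F.
Proof. by rewrite /vmean -scaler_sumr !scalerA mulrC. Qed.

Lemma vmean_sum (I : finType) (P : pred I) (F : I -> T -> 'rV[R]_d) :
  vmean (fun t => \sum_(i | P i) F i t) = \sum_(i | P i) vmean (F i).
Proof. by rewrite /vmean exchange_big -scaler_sumr. Qed.

Lemma vmean_cst v : (0 < #|T|)%N -> vmean (fun=> v) = v.
Proof. by move=> T0; apply/rowP => j; rewrite vmeanE mean_cst. Qed.

Lemma vmean_mulmx F (A : 'M[R]_d) : vmean (fun t => F t *m A) = vmean F *m A.
Proof. by rewrite /vmean -mulmx_suml scalemxAl. Qed.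

Lemma edot_vmean v F : edot v (vmean F) = mean (fun t => edot v (F t)).
Proof. by rewrite /vmean edotZr edot_sumr. Qed.

Lemma enorm_vmean F : enorm (vmean F) <= mean (fun t => enorm (F t)).
Proof.
rewrite enormZ ger0_norm ?invr_ge0 // ler_wpM2l ?invr_ge0 //.
exact: enorm_sum_le.
Qed.

(** The variance is the second moment minus the squared norm of the mean. *)
Lemma sqr_enorm_center_le F : (0 < #|T|)%N ->
  mean (fun t => enorm (F t - vmean F) ^+ 2) <= mean (fun t => enorm (F t) ^+ 2).
Proof.
move=> T0; set m := vmean F.
rewrite (_ : mean _ =
    mean (fun t => enorm (F t) ^+ 2) - enorm m ^+ 2) ?gerBl ?sqr_ge0 //.
rewrite (@eq_mean _ (fun t => enorm (F t) ^+ 2 + (- 2 * edot m (F t) + enorm m ^+ 2))).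
  by rewrite !meanD meanZ mean_cst // -edot_vmean -/m -sqr_enorm; ring.
by move=> t; rewrite sqr_enormB edotC; ring.
Qed.

End Vector.
End Mean.

Lemma vmean_exchange (R : realType) (T U : finType) d (F : T -> U -> 'rV[R]_d) :
  vmean (fun t => vmean (F t)) = vmean (fun u => vmean (F^~ u)).
Proof. by rewrite /vmean -!scaler_sumr exchange_big !scalerA mulrC. Qed.

Section Permutations.
Context (R : realType) (n : nat).
Implicit Types (s t : 'S_n) (i j l : 'I_n).

Lemma card_perm_gt0 : (0 < #|{: 'S_n}|)%N.
Proof. by apply/card_gt0P; exists 1%g. Qed.

Lemma mean_permM t (phi : 'S_n -> R) :
  mean (fun s => phi (t * s)%g) = mean phi.
Proof. by rewrite /mean [in RHS](reindex_inj (mulgI t)). Qed.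

Lemma vmean_permM d t (F : 'S_n -> 'rV[R]_d) :
  vmean (fun s => F (t * s)%g) = vmean F.
Proof. by apply/rowP => j; rewrite !vmeanE (mean_permM t (fun s => F s 0 j)). Qed.

(** A transposition shows that all positions have the same law, and summing over positions gives the
    sum over values, whatever the permutation. *)
Lemma mean_perm_at i (phi : 'I_n -> R) : mean (fun s : 'S_n => phi (s i)) = mean phi.
Proof.
have n0 : (n%:R : R) != 0 by rewrite pnatr_eq0 -lt0n (leq_ltn_trans _ (ltn_ord i)).
have H l : mean (fun s : 'S_n => phi (s l)) = mean (fun s : 'S_n => phi (s i)).
  rewrite -(mean_permM (tperm i l) (fun s => phi (s i))); apply: eq_mean => s.
  by rewrite permM tpermL.
have : \sum_l mean (fun s : 'S_n => phi (s l)) =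
    n%:R * mean (fun s : 'S_n => phi (s i)).
  by under eq_bigr do rewrite H; rewrite sumr_const card_ord mulr_natl.
rewrite -mean_sum (@eq_mean _ _ _ (fun=> \sum_a phi a)); last first.
  by move=> s; rewrite [RHS](reindex_inj (@perm_inj _ s)).
rewrite mean_cst ?card_perm_gt0 // /mean card_ord => ->.
by rewrite mulKf.
Qed.

Lemma vmean_perm_at d i (F : 'I_n -> 'rV[R]_d) :
  vmean (fun s : 'S_n => F (s i)) = vmean F.
Proof.
by apply/rowP => j; rewrite !vmeanE (mean_perm_at i (fun a => F a 0 j)).
Qed.

(** * Second moment of sums sampled without replacement, with position-dependent weights *)

Section WithoutReplacement.
Context (d : nat) (w : 'I_n -> 'I_n -> 'rV[R]_d).
Hypothesis n_gt1 : (1 < n)%N.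
Hypothesis w_centered : forall i, \sum_a w i a = 0.

Let A i := mean (fun a => enorm (w i a) ^+ 2).
Let c i j := mean (fun s : 'S_n => edot (w i (s i)) (w j (s j))).

(* Given s(i), the value s(j) is uniform on the other indices, and the
   centered vectors w_j there sum to - w_j (s(i)). *)
Lemma mean_edot_offdiag i j : j != i -> c i j <= (A i + A j) / 2 / n.-1%:R.
Proof.
move=> ij; have n1 : 0 < (n.-1%:R : R) by rewrite ltr0n -subn1 subn_gt0.
have H l : l != i -> mean (fun s : 'S_n => edot (w i (s i)) (w j (s l))) = c i j.
  move=> li; rewrite /c -(mean_permM (tperm j l) (fun s => edot (w i (s i)) (w j (s j)))).
  apply: eq_mean => s.
  by rewrite !permM tpermL tpermD.
have : \sum_(l | l != i) mean (fun s : 'S_n => edot (w i (s i)) (w j (s l))) =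
    n.-1%:R * c i j.
  by rewrite (eq_bigr _ H) sumr_const cardC1 card_ord mulr_natl.
rewrite -mean_sum.
rewrite (@eq_mean _ _ _ (fun s => - 1 * edot (w i (s i)) (w j (s i)))); last first.
  move=> s; rewrite -edot_sumr mulN1r -edotNr; congr edot.
  have := w_centered j; rewrite (reindex_inj (@perm_inj _ s)) (bigD1 i) //= => /eqP.
  by rewrite addrC addr_eq0 => /eqP.
rewrite meanZ (mean_perm_at i (fun a => edot (w i a) (w j a))) => E.
rewrite ler_pdivlMr // mulrC -E -meanZ /A -meanD mulrC -meanZ.
apply: le_mean => a.
by have := sqr_ge0 (enorm (w i a + w j a)); rewrite sqr_enormD; lra.
Qed.

Lemma sum_offdiag (P : pred 'I_n) (B : 'I_n -> R) : (forall i, 0 <= B i) ->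
  \sum_(i | P i) \sum_(j | P j && (j != i)) B i <= n.-1%:R * \sum_(i | P i) B i.
Proof.
move=> B0; rewrite mulr_sumr; apply: ler_sum => i _.
rewrite sumr_const -[B i *+ _]mulr_natl ler_wpM2r // ler_nat.
apply: (@leq_trans #|[pred j | j != i]|).
  by apply/subset_leq_card/fintype.subsetP => j; rewrite !inE => /andP[].
by rewrite cardC1 card_ord.
Qed.

(** The diagonal gives the sum once. Off the diagonal each position has at most [n.-1] partners,
    each weighted by [1 / n.-1], so these pairs cost at most the same sum again: hence the factor
    2. *)
Lemma mean_sqr_enorm_without_replacement (P : pred 'I_n) :
  mean (fun s : 'S_n => enorm (\sum_(i | P i) w i (s i)) ^+ 2) <=
  2 * \sum_(i | P i) mean (fun a => enorm (w i a) ^+ 2).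
Proof.
have A0 i : 0 <= A i by apply: mean_ge0 => a; exact: sqr_ge0.
have n1 : 0 < (n.-1%:R : R) by rewrite ltr0n -subn1 subn_gt0.
have -> : mean (fun s : 'S_n => enorm (\sum_(i | P i) w i (s i)) ^+ 2) =
    \sum_(i | P i) \sum_(j | P j) c i j.
  under [RHS]eq_bigr do rewrite -mean_sum.
  rewrite -[RHS]mean_sum; apply: eq_mean => s.
  by rewrite sqr_enorm edot_suml; apply: eq_bigr => i _; rewrite edot_sumr.
have cii i : c i i = A i.
  rewrite /A -(mean_perm_at i); apply: eq_mean => s.
  by rewrite sqr_enorm.
apply: (@le_trans _ _ (\sum_(i | P i) (A i +
    \sum_(j | P j && (j != i)) (A i + A j) / 2 / n.-1%:R))).
  apply: ler_sum => i Pi; rewrite (bigD1 i) //= cii lerD2l.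
  by apply: ler_sum => j /andP[_ ji]; exact: mean_edot_offdiag.
rewrite big_split mulr_natl mulr2n lerD2l.
under eq_bigr do rewrite -!mulr_suml big_split.
rewrite -!mulr_suml big_split /= !ler_pdivrMr //.
have h1 := sum_offdiag P A0.
have h2 : \sum_(i | P i) \sum_(j | P j && (j != i)) A j <=
    n.-1%:R * \sum_(i | P i) A i.
  rewrite (exchange_big_dep P) /=; last by move=> i j _ /andP[].
  apply: le_trans (sum_offdiag P A0); apply: ler_sum => j Pj.
  by rewrite (eq_bigl (fun i => P i && (i != j))) // => i; rewrite Pj eq_sym.
by rewrite (_ : _ * n.-1%:R * 2 = 2 * (n.-1%:R * \sum_(i | P i) A i)); [lra | ring].
Qed.

End WithoutReplacement.
End Permutations.

(** * One epoch *)

Section OrdinalSums.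
Context (n : nat).

Lemma sum_ord_ltS (V : nmodType) (F : 'I_n -> V) (i : 'I_n) :
  \sum_(j < n | (j < i.+1)%N) F j = \sum_(j < n | (j < i)%N) F j + F i.
Proof.
rewrite (bigD1 i) //= addrC; congr (_ + _); apply: eq_bigl => j.
by rewrite ltnS [RHS]ltn_neqAle andbC.
Qed.

Lemma sum_ord_lt0 (V : nmodType) (F : 'I_n -> V) :
  \sum_(j < n | (j < 0)%N) F j = 0.
Proof. by rewrite big_pred0. Qed.

Lemma sum_ord_lt_all (V : nmodType) (F : 'I_n -> V) :
  \sum_(j < n | (j < n)%N) F j = \sum_(j < n) F j.
Proof. by apply: eq_bigl => j; rewrite ltn_ord. Qed.

Lemma card_ord_lt k : (k <= n)%N -> #|[pred j : 'I_n | (j < k)%N]| = k.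
Proof.
rewrite -sum1_card; elim: k => [_|k IH kn]; first exact: sum_ord_lt0.
have e2 := sum_ord_ltS (fun=> 1%N) (Ordinal kn).
have e1 := IH (ltnW kn); rewrite -[RHS]addn1 -[in RHS]e1.
by apply: etrans e2; apply: eq_bigl.
Qed.

Context (R : realFieldType).

Lemma sum_ord_lt_cst (c : R) k : (k <= n)%N ->
  \sum_(j < n | (j < k)%N) c = k%:R * c.
Proof. by move=> kn; rewrite sumr_const card_ord_lt // mulr_natl. Qed.

Lemma sum_ord_lt_id k : (k <= n)%N ->
  \sum_(j < n | (j < k)%N) (j%:R : R) <= k%:R ^+ 2 / 2.
Proof.
elim: k => [_|k IH kn]; first by rewrite sum_ord_lt0 expr0n mul0r.
rewrite (sum_ord_ltS (fun j => j%:R) (Ordinal kn)) /= -(natr1 k).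
by have := IH (ltnW kn); nra.
Qed.

Lemma sum_ord_lt_sqr k : (k <= n)%N ->
  \sum_(j < n | (j < k)%N) (j%:R ^+ 2 : R) <= k%:R ^+ 3 / 3.
Proof.
elim: k => [_|k IH kn]; first by rewrite sum_ord_lt0 expr0n mul0r.
rewrite (sum_ord_ltS (fun j => j%:R ^+ 2) (Ordinal kn)) /= -(natr1 k).
by have := IH (ltnW kn); have : (0 : R) <= k%:R by []; nra.
Qed.

(** A second-order companion of Bernoulli's inequality, turning a per-step contraction into one that
    is linear in the number of steps. *)
Lemma expr1B_le (s : R) k : 0 <= s -> s <= 1 ->
  (1 - s) ^+ k <= 1 - k%:R * s + (k%:R * s) ^+ 2 / 2.
Proof.
move=> s0 s1; elim: k => [|k IH]; first by rewrite expr0 mul0r expr0n /=; lra.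
rewrite exprS; apply: (@le_trans _ _ ((1 - s) * (1 - k%:R * s + (k%:R * s) ^+ 2 / 2))).
  by rewrite ler_wpM2l // subr_ge0.
rewrite -(natr1 k); set x := k%:R; have x0 : 0 <= x by [].
have : 0 <= x ^+ 2 * s ^+ 3 by rewrite mulr_ge0 ?exprn_ge0.
have := sqr_ge0 s; lra.
Qed.

End OrdinalSums.

(** * One epoch, with abstract component gradients [g] and Hessian [A] of the average *)

Section Epoch.
Context (R : realType) (d n : nat) (g : 'I_n -> 'rV[R]_d -> 'rV[R]_d).
Context (A : 'rV[R]_d -> 'M[R]_d) (xs y : 'rV[R]_d) (L mu rho eta D G : R).
Implicit Types (s : 'S_n) (i j l : 'I_n) (k : nat) (u v : 'rV[R]_d).

Let N : R := n%:R.
Let gbar u := vmean (fun i => g i u).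

Hypothesis n_gt1 : (1 < n)%N.
Hypothesis eta_gt0 : 0 < eta.
Hypothesis mu_gt0 : 0 < mu.
Hypothesis mu_leL : mu <= L.
Hypothesis small_step : N * eta * L ^+ 2 <= mu / 32.
Hypothesis g_lip : forall i u v, enorm (g i u - g i v) <= L * enorm (u - v).
Hypothesis gbar_mono : forall u,
  mu * enorm (u - xs) ^+ 2 <= edot (u - xs) (gbar u).
Hypothesis gbar_xs : gbar xs = 0.
Hypothesis D_ge0 : 0 <= D.
Hypothesis G_ge : 2 * L * D <= G.
Hypothesis G_le : G <= 4 * L * D.
Hypothesis g_bound : forall i u, enorm (u - xs) <= 2 * D -> enorm (g i u) <= G.
Hypothesis rho_ge0 : 0 <= rho.
Hypothesis A_bound : forall u v, enorm (v *m A u) <= L * enorm v.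
Hypothesis gbar_taylor : forall u v,
  enorm (gbar u - gbar v - (u - v) *m A v) <= rho / 2 * enorm (u - v) ^+ 2.
Hypothesis y_ball : enorm (y - xs) <= D.

Let eta_ge0 : 0 <= eta. Proof. exact: ltW. Qed.
Let L_gt0 : 0 < L. Proof. exact: lt_le_trans mu_leL. Qed.
Let N_gt0 : 0 < N. Proof. by rewrite ltr0n ltnW. Qed.
Let ordT_gt0 : (0 < #|'I_n|)%N. Proof. by rewrite card_ord ltnW. Qed.
Let G_ge0 : 0 <= G.
Proof. by apply: le_trans G_ge; rewrite !mulr_ge0 // ltW. Qed.

Let small_L : N * eta * L <= 1 / 32.
Proof.
rewrite -(ler_pM2r L_gt0) (_ : N * eta * L * L = N * eta * L ^+ 2); last by ring.
by apply: le_trans small_step _; move: mu_leL; lra.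
Qed.

Let small_mu : N * eta * mu <= 1 / 32.
Proof.
by apply: le_trans small_L; rewrite ler_wpM2l // mulr_ge0 // ltW.
Qed.

Lemma le_natN k : (k <= n)%N -> (k%:R : R) <= N.
Proof. by move=> kn; rewrite ler_nat. Qed.

Lemma gbar_lip u v : enorm (gbar u - gbar v) <= L * enorm (u - v).
Proof.
rewrite -vmeanB; apply: le_trans (enorm_vmean _) _.
by rewrite -[leRHS](mean_cst _ ordT_gt0); apply: le_mean => i; exact: g_lip.
Qed.

Lemma gbar_le u : enorm (gbar u) <= L * enorm (u - xs).
Proof. by have := gbar_lip u xs; rewrite gbar_xs subr0. Qed.

(** Monotonicity gains [2 * a * mu] and the quadratic term loses at most [a * mu / 32]. The step [a]
    is free because both [eta] and the aggregated step [N * eta] are used. *)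
Lemma gd_step a u : 0 <= a -> a * L ^+ 2 <= mu / 32 ->
  enorm (u - a *: gbar u - xs) ^+ 2 <=
    (1 - 63 / 32 * (a * mu)) * enorm (u - xs) ^+ 2.
Proof.
move=> a0 aL; rewrite addrAC (sqr_enormB (u - xs)) enormZ edotZr ger0_norm //.
have h1 := ler_wpM2l a0 (gbar_mono u).
have h2 : (a * enorm (gbar u)) ^+ 2 <= a * (mu / 32) * enorm (u - xs) ^+ 2.
  apply: (@le_trans _ _ (a ^+ 2 * (L * enorm (u - xs)) ^+ 2)).
    rewrite exprMn ler_wpM2l ?sqr_ge0 // ler_pXn2r ?gbar_le //.
      by rewrite nnegrE enorm_ge0.
    by rewrite nnegrE (le_trans (enorm_ge0 _) (gbar_le u)).
  rewrite exprMn mulrA ler_wpM2r ?sqr_ge0 //.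
  by rewrite expr2 -mulrA ler_wpM2l.
by lra.
Qed.

Let step_eta : eta * L ^+ 2 <= mu / 32.
Proof.
apply: le_trans small_step; rewrite -[eta * _]mul1r -mulrA ler_wpM2r //.
  by rewrite mulr_ge0 ?sqr_ge0.
by rewrite (@le_natN 1) // ltnW.
Qed.

(** * Deterministic gradient descent on the average *)

Let gd k : 'rV[R]_d := iter k (fun u => u - eta *: gbar u) y.

Lemma gd_ball k : enorm (gd k - xs) <= D.
Proof.
elim: k => [|k IH] //=.
rewrite -(@ler_pXn2r _ 2) ?nnegrE ?enorm_ge0 //.
apply: le_trans (gd_step _ eta_ge0 step_eta) _.
have h : enorm (gd k - xs) ^+ 2 <= D ^+ 2.
  by rewrite ler_pXn2r ?nnegrE ?enorm_ge0.
apply: le_trans h; rewrite ler_piMl ?sqr_ge0 // gerBl.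
by rewrite !mulr_ge0 // ltW.
Qed.

Lemma gd_dist k : enorm (gd k - y) <= k%:R * (eta * G / 2).
Proof.
elim: k => [|k IH] /=; first by rewrite subrr enorm0 mul0r.
rewrite addrAC -natr1 mulrDl mul1r; apply: le_trans (enormB_le _ _) _.
apply: lerD => //; rewrite enormZ ger0_norm // -mulrA ler_wpM2l //.
apply: le_trans (gbar_le _) _.
(* The half in the claim comes from [L * D <= G / 2]. *)
have := ler_wpM2l (ltW L_gt0) (gd_ball k); move: G_ge; lra.
Qed.

Lemma gd_contract :
  enorm (gd n - xs) ^+ 2 <= (1 - 19 / 10 * (N * eta * mu)) * enorm (y - xs) ^+ 2.
Proof.
pose q := 63 / 32 * (eta * mu).
have em0 : 0 <= eta * mu by rewrite mulr_ge0 // ltW.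
have q0 : 0 <= q by rewrite /q mulr_ge0.
have Nq : N * q <= 63 / 1024 by rewrite /q; move: small_mu; lra.
have q1 : q <= 1.
  have : 1 * q <= N * q by rewrite ler_wpM2r // (@le_natN 1) // ltnW.
  by rewrite mul1r => h; lra.
have h k : enorm (gd k - xs) ^+ 2 <= (1 - q) ^+ k * enorm (y - xs) ^+ 2.
  elim: k => [|k IH]; first by rewrite expr0 mul1r.
  apply: le_trans (gd_step _ eta_ge0 step_eta) _; rewrite [(1 - q) ^+ k.+1]exprS -[leRHS]mulrA -/q.
  by rewrite ler_wpM2l // subr_ge0.
apply: le_trans (h n) _; rewrite ler_wpM2r ?sqr_ge0 //.
(* With [N * q <= 63 / 1024], the quadratic term lowers the rate from [63 / 32] to no less than
   [19 / 10]. *)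
apply: le_trans (expr1B_le n q0 q1) _.
have Nq0 : 0 <= N * q by rewrite mulr_ge0 // ltW.
have -> : n%:R * q = N * q by [].
have -> : N * eta * mu = 32 / 63 * (N * q) by rewrite /q; field.
by have := ler_wpM2l Nq0 Nq; lra.
Qed.

(** * The reshuffled path inside the epoch *)

Let rrpath s k : 'rV[R]_d :=
  foldl (fun x i => x - eta *: g (s i) x) y (take k (enum 'I_n)).

Lemma rrpath0 s : rrpath s 0 = y.
Proof. by rewrite /rrpath take0. Qed.

Lemma rrpathS s i : rrpath s i.+1 = rrpath s i - eta *: g (s i) (rrpath s i).
Proof.
rewrite /rrpath (take_nth i) ?size_enum_ord //.
by rewrite nth_ord_enum -cats1 foldl_cat.
Qed.

Lemma rrpath_bound s k : (k <= n)%N ->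
  enorm (rrpath s k - y) <= k%:R * (eta * G) /\ enorm (rrpath s k - xs) <= 2 * D.
Proof.
(* The total displacement is at most [N * eta * G <= 4 * (N * eta * L) * D <= D / 8]. Staying in the
   ball of radius [2 * D] bounds the next gradient by [G], which carries the induction. *)
have key k' u : (k' <= n)%N -> enorm (u - y) <= k'%:R * (eta * G) ->
    enorm (u - xs) <= 2 * D.
  move=> kn hu; apply: le_trans (enorm_dist_triangle y _ _) _.
  have h1 : k'%:R * (eta * G) <= N * (eta * G).
    by rewrite ler_wpM2r ?le_natN // mulr_ge0.
  have h2 : N * (eta * G) <= N * eta * (4 * L * D).
    by rewrite mulrA ler_wpM2l // mulr_ge0 // ltW.
  have := ler_wpM2r D_ge0 small_L; move: y_ball D_ge0; lra.
move=> kn; suff h : enorm (rrpath s k - y) <= k%:R * (eta * G) by split => //; exact: key h.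
elim: k kn => [|k IH] kn; first by rewrite rrpath0 subrr enorm0 mul0r.
have hk := IH (ltnW kn); rewrite (rrpathS s (Ordinal kn)) /= addrAC -natr1 mulrDl mul1r.
apply: le_trans (enormB_le _ _) _; apply: lerD => //.
by rewrite enormZ ger0_norm // ler_wpM2l // g_bound // (key k) // ltnW.
Qed.

Lemma rrpath_sum s k : (k <= n)%N ->
  rrpath s k = y - eta *: \sum_(j < n | (j < k)%N) g (s j) (rrpath s j).
Proof.
elim: k => [|k IH] kn; first by rewrite sum_ord_lt0 scaler0 subr0 rrpath0.
rewrite (rrpathS s (Ordinal kn)) /= (sum_ord_ltS _ (Ordinal kn)) /=.
by rewrite {1}IH ?(ltnW kn) // scalerDr opprD addrA.
Qed.

Lemma gd_sum k : (k <= n)%N ->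
  gd k = y - eta *: \sum_(j < n | (j < k)%N) gbar (gd j).
Proof.
elim: k => [|k IH] kn; first by rewrite sum_ord_lt0 scaler0 subr0.
rewrite (sum_ord_ltS _ (Ordinal kn)) /=.
by rewrite {1}IH ?(ltnW kn) // scalerDr opprD addrA.
Qed.

Lemma sum_perm s (F : 'I_n -> 'rV[R]_d) : \sum_j F (s j) = \sum_j F j.
Proof. by rewrite [RHS](reindex_inj (@perm_inj _ s)). Qed.

Lemma N_gbar u : \sum_j g j u = N *: gbar u.
Proof. by rewrite /gbar /vmean card_ord scalerA divff ?scale1r // gt_eqF. Qed.

(** A whole epoch is one gradient step of length [N * eta] at [y], in which the permutation
    disappears, plus an error smaller than the gain of that step. *)
Lemma epoch_ball s : enorm (rrpath s n - xs) <= D.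
Proof.
have E : rrpath s n - xs = (y - (N * eta) *: gbar y - xs) -
    eta *: \sum_j (g (s j) (rrpath s j) - g (s j) y).
  rewrite rrpath_sum // sum_ord_lt_all sumrB (sum_perm s (g^~ y)) N_gbar.
  by apply/rowP => j; rewrite !mxE; ring.
rewrite E; apply: le_trans (enormB_le _ _) _.
have Ne0 : 0 <= N * eta by rewrite mulr_ge0 // ltW.
have am0 : 0 <= N * eta * mu by rewrite mulr_ge0 // ltW.
(* Half the rate of [gd_step], by passing to square roots. *)
have h1 : enorm (y - (N * eta) *: gbar y - xs) <= (1 - 63 / 64 * (N * eta * mu)) * D.
  rewrite -(@ler_pXn2r _ 2) ?nnegrE ?enorm_ge0 //; last first.
    by rewrite mulr_ge0 // subr_ge0; move: small_mu; lra.
  apply: le_trans (gd_step _ Ne0 small_step) _; rewrite exprMn.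
  apply: (@le_trans _ _ ((1 - 63 / 32 * (N * eta * mu)) * D ^+ 2)).
    rewrite ler_wpM2l ?ler_pXn2r ?nnegrE ?enorm_ge0 //.
    by rewrite subr_ge0; move: small_mu; lra.
  rewrite ler_wpM2r ?sqr_ge0 //.
  have := sqr_ge0 (N * eta * mu); lra.
have h2 : enorm (eta *: \sum_j (g (s j) (rrpath s j) - g (s j) y)) <=
    N * eta * mu * D / 8.
  rewrite enormZ ger0_norm //.
  apply: (@le_trans _ _ (eta * (N * (L * (N * (eta * G)))))).
    rewrite ler_wpM2l //; apply: le_trans (enorm_sum_le _ _ _) _.
    rewrite -[N * (L * _)](@sum_ord_lt_cst n _ _ n) // sum_ord_lt_all.
    apply: ler_sum => j _; apply: le_trans (g_lip _ _ _) _.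
    rewrite ler_wpM2l ?(ltW L_gt0) //.
    have [h _] := rrpath_bound s (ltnW (ltn_ord j)); apply: le_trans h _.
    by rewrite ler_wpM2r ?mulr_ge0 // le_natN // ltnW.
  have h3 : (N * eta) ^+ 2 * L * G <= (N * eta) ^+ 2 * L * (4 * L * D).
    by rewrite ler_wpM2l // mulr_ge0 ?sqr_ge0 // ltW.
  have := ler_wpM2l (mulr_ge0 Ne0 D_ge0) small_step; lra.
have := mulr_ge0 am0 D_ge0; lra.
Qed.


(** * Second moments of the deviation between the two paths *)

Let delta s k := rrpath s k - gd k.
(** As [gd j] is deterministic, [noise j] is a centered family sampled without replacement. All
    dependence on the random path is left to [drift], which the Lipschitz bound controls by
    [delta]. *)
Let noise j i := g i (gd j) - gbar (gd j).
Let drift s (j : 'I_n) := g (s j) (rrpath s j) - g (s j) (gd j).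

Lemma drift_le s j : enorm (drift s j) <= L * enorm (delta s j).
Proof. exact: g_lip. Qed.

Lemma delta_sum s k : (k <= n)%N ->
  delta s k = - (eta *: (\sum_(j < n | (j < k)%N) noise j (s j) +
                         \sum_(j < n | (j < k)%N) drift s j)).
Proof.
move=> kn; rewrite /delta rrpath_sum // gd_sum // -big_split /=.
have -> : \sum_(j < n | (j < k)%N) (noise j (s j) + drift s j) =
    \sum_(j < n | (j < k)%N) (g (s j) (rrpath s j) - gbar (gd j)).
  by apply: eq_bigr => j _; apply/rowP => a; rewrite /noise /drift !mxE; ring.
by rewrite sumrB; apply/rowP => a; rewrite !mxE; ring.
Qed.

Lemma sum_centered u : \sum_i (g i u - gbar u) = 0.
Proof. by rewrite sumrB N_gbar sumr_const card_ord scaler_nat subrr. Qed.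

(** Cauchy-Schwarz over [k] terms. The bound on earlier deviations is a hypothesis so that it can be
    an induction hypothesis. *)
Lemma mean_sqr_drift_sum k (c : R) : (k <= n)%N ->
  (forall j, (j < k)%N -> mean (fun s => enorm (delta s j) ^+ 2) <= c * j%:R) ->
  mean (fun s => enorm (\sum_(j < n | (j < k)%N) drift s j) ^+ 2) <=
    k%:R * L ^+ 2 * \sum_(j < n | (j < k)%N) c * j%:R.
Proof.
move=> kn hc.
apply: (@le_trans _ _ (mean (fun s => k%:R * L ^+ 2 *
    \sum_(j < n | (j < k)%N) enorm (delta s j) ^+ 2))).
  apply: le_mean => s; apply: le_trans (sqr_enorm_sum_le _ _) _.
  rewrite (card_ord_lt kn) -mulrA ler_wpM2l // mulr_sumr; apply: ler_sum => j _.
  rewrite -exprMn ler_pXn2r ?nnegrE ?enorm_ge0 ?drift_le //.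
  by rewrite mulr_ge0 ?enorm_ge0 // ltW.
rewrite meanZ mean_sum ler_wpM2l ?(mulr_ge0 _ (sqr_ge0 _)) //.
by apply: ler_sum => j jk; exact: hc.
Qed.

Lemma mean_sqr_delta k : (k <= n)%N ->
  mean (fun s => enorm (delta s k) ^+ 2) <= 12 / 5 * (eta * G) ^+ 2 * k%:R.
Proof.
elim/ltn_ind: k => k IH kn.
set c := 12 / 5 * (eta * G) ^+ 2.
have k0 : (0 : R) <= k%:R by [].
have c0 : 0 <= c by rewrite mulr_ge0 ?sqr_ge0.
have hH : mean (fun s => enorm (\sum_(j < n | (j < k)%N) drift s j) ^+ 2) <=
    k%:R * L ^+ 2 * (k%:R * (c * k%:R)).
  apply: le_trans (mean_sqr_drift_sum kn (c := c) _) _ => [j jk|].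
    by apply: IH => //; exact: leq_trans (ltnW jk) kn.
  rewrite ler_wpM2l ?(mulr_ge0 _ (sqr_ge0 _)) // -(@sum_ord_lt_cst n) //.
  by apply: ler_sum => j jk; rewrite ler_wpM2l // ler_nat ltnW.
have hW : mean (fun s : 'S_n => enorm (\sum_(j < n | (j < k)%N) noise j (s j)) ^+ 2) <=
    2 * (k%:R * G ^+ 2).
  apply: le_trans (mean_sqr_enorm_without_replacement (w := noise) n_gt1 _ _) _.
    by move=> j; exact: sum_centered.
  rewrite ler_wpM2l // -(@sum_ord_lt_cst n) //; apply: ler_sum => j _.
  apply: le_trans (sqr_enorm_center_le (fun i => g i (gd j)) ordT_gt0) _.
  rewrite -[leRHS](mean_cst _ ordT_gt0); apply: le_mean => i.
  rewrite ler_pXn2r ?nnegrE ?enorm_ge0 // g_bound //.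
  by apply: le_trans (gd_ball _) _; move: D_ge0; lra.
(* Young's weight [8^-1] favors the dominant noise. As [(k * eta * L) ^+ 2 <= 1 / 1024], the
   constant [12 / 5] closes the induction: [9 / 4 + 9 / 1024 * (12 / 5) <= 12 / 5]. *)
apply: (@le_trans _ _ (eta ^+ 2 * ((1 + 8^-1) * (2 * (k%:R * G ^+ 2)) +
    (1 + 8^-1^-1) * (k%:R * L ^+ 2 * (k%:R * (c * k%:R)))))).
  apply: (@le_trans _ _ (mean (fun s => eta ^+ 2 *
      ((1 + 8^-1) * enorm (\sum_(j < n | (j < k)%N) noise j (s j)) ^+ 2 +
       (1 + 8^-1^-1) * enorm (\sum_(j < n | (j < k)%N) drift s j) ^+ 2)))).
    apply: le_mean => s; rewrite delta_sum // enormN enormZ exprMn.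
    rewrite real_normK ?num_real // ler_wpM2l ?sqr_ge0 //.
    by apply: sqr_enormD_le; rewrite invr_gt0.
  rewrite meanZ meanD !meanZ ler_wpM2l ?sqr_ge0 //.
  by apply: lerD; rewrite ler_wpM2l // addr_ge0 ?invr_ge0.
have hk : (k%:R * eta * L) ^+ 2 <= (1 / 32) ^+ 2.
  have kNe : k%:R * eta * L <= N * eta * L.
    by rewrite ler_wpM2r ?(ltW L_gt0) // ler_wpM2r // le_natN.
  rewrite ler_pXn2r ?nnegrE //; last by rewrite !mulr_ge0 // ltW.
  exact: le_trans kNe small_L.
have := ler_wpM2r (mulr_ge0 c0 k0) hk.
have : 0 <= (eta * G) ^+ 2 * k%:R by rewrite mulr_ge0 ?sqr_ge0.
rewrite /c invrK; lra.
Qed.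

(* The mean of the increments along the full epoch vanishes exactly, so only
   their drift [noise j - noise 0] contributes to the fluctuation of the endpoint. *)
Lemma mean_sqr_delta_end :
  mean (fun s => enorm (delta s n) ^+ 2) <=
    3 * (N ^+ 3 * eta ^+ 4 * L ^+ 2 * G ^+ 2).
Proof.
pose noise' j i := (g i (gd j) - g i y) - (gbar (gd j) - gbar y).
have ww s : \sum_(j < n | (j < n)%N) noise j (s j) = \sum_(j < n | (j < n)%N) noise' j (s j).
  apply/eqP; rewrite !sum_ord_lt_all -subr_eq0 -sumrB.
  rewrite (eq_bigr (fun j => g (s j) y - gbar y)); last first.
    by move=> j _; apply/rowP => a; rewrite /noise /noise' !mxE; ring.
  by rewrite (sum_perm s (fun i => g i y - gbar y)) sum_centered.
set c := 12 / 5 * (eta * G) ^+ 2.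
have c0 : 0 <= c by rewrite mulr_ge0 ?sqr_ge0.
have hH : mean (fun s => enorm (\sum_(j < n | (j < n)%N) drift s j) ^+ 2) <=
    N * L ^+ 2 * (c * (N ^+ 2 / 2)).
  apply: le_trans (mean_sqr_drift_sum (leqnn n) (c := c) _) _ => [j jk|].
    by apply: mean_sqr_delta; exact: ltnW.
  rewrite ler_wpM2l ?(mulr_ge0 _ (sqr_ge0 _)) //.
  by rewrite -mulr_sumr ler_wpM2l // sum_ord_lt_id.
have hW : mean (fun s : 'S_n => enorm (\sum_(j < n | (j < n)%N) noise' j (s j)) ^+ 2) <=
    2 * ((L * (eta * G / 2)) ^+ 2 * (N ^+ 3 / 3)).
  apply: le_trans (mean_sqr_enorm_without_replacement (w := noise') n_gt1 _ _) _.
    move=> j; rewrite (eq_bigr (fun i => (g i (gd j) - gbar (gd j)) - (g i y - gbar y))).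
      by rewrite sumrB !sum_centered subrr.
    by move=> i _; apply/rowP => a; rewrite /noise' !mxE; ring.
  rewrite ler_wpM2l //.
  apply: (@le_trans _ _ ((L * (eta * G / 2)) ^+ 2 *
      \sum_(j < n | (j < n)%N) (j%:R ^+ 2 : R))); last first.
    by rewrite ler_wpM2l ?sqr_ge0 // sum_ord_lt_sqr.
  rewrite mulr_sumr; apply: ler_sum => j _.
  rewrite (@eq_mean _ _ _ (fun i => enorm ((g i (gd j) - g i y) -
      vmean (fun i => g i (gd j) - g i y)) ^+ 2)); last first.
    by move=> i; rewrite vmeanB.
  apply: le_trans (sqr_enorm_center_le _ ordT_gt0) _.
  rewrite -[leRHS](mean_cst _ ordT_gt0); apply: le_mean => i.
  rewrite -exprMn ler_pXn2r ?nnegrE ?enorm_ge0 //; last first.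
    by rewrite !mulr_ge0 // ltW.
  apply: le_trans (g_lip _ _ _) _; rewrite -[leRHS]mulrA ler_wpM2l ?(ltW L_gt0) //.
  by rewrite mulrC; exact: gd_dist.
(* Both contributions now have the same order, hence equal weights; they add up to
   [1 / 3 + 12 / 5 <= 3]. *)
apply: (@le_trans _ _ (eta ^+ 2 * ((1 + 1) * (2 * ((L * (eta * G / 2)) ^+ 2 *
    (N ^+ 3 / 3))) + (1 + 1^-1) * (N * L ^+ 2 * (c * (N ^+ 2 / 2)))))).
  apply: (@le_trans _ _ (mean (fun s => eta ^+ 2 *
      ((1 + 1) * enorm (\sum_(j < n | (j < n)%N) noise' j (s j)) ^+ 2 +
       (1 + 1^-1) * enorm (\sum_(j < n | (j < n)%N) drift s j) ^+ 2)))).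
    apply: le_mean => s; rewrite delta_sum // ww enormN enormZ exprMn.
    rewrite real_normK ?num_real // ler_wpM2l ?sqr_ge0 //.
    exact: sqr_enormD_le.
  rewrite meanZ meanD !meanZ ler_wpM2l ?sqr_ge0 //.
  by apply: lerD; rewrite ler_wpM2l // invr1 addr_ge0.
have : 0 <= N ^+ 3 * eta ^+ 4 * L ^+ 2 * G ^+ 2.
  by rewrite !mulr_ge0 ?exprn_ge0 // ltW.
rewrite /c invr1; lra.
Qed.

(** * Bias of the deviation *)

Lemma rrpath_eq s s' k : (k <= n)%N ->
  (forall j, (j < k)%N -> s j = s' j) -> rrpath s k = rrpath s' k.
Proof.
elim: k => [|k IH] kn hs; first by rewrite !rrpath0.
rewrite !(rrpathS _ (Ordinal kn)) /= IH ?hs ?(ltnW kn) // => j jk.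
by apply: hs; exact: ltnW.
Qed.

(** The paths agree up to step [l], separate there by at most [2 * eta * G], and then spread by a
    factor [1 + eta * L] per step. Since [k * eta * L <= 1 / 32], a linear factor dominates this
    growth. *)
Lemma rrpath_swap s s' l k : (k <= n)%N -> (l < k)%N ->
  (forall j, (j < k)%N -> j != l -> s j = s' j) ->
  enorm (rrpath s k - rrpath s' k) <= 2 * (eta * G) * (1 + 2 * (k%:R * (eta * L))).
Proof.
elim: k => [//|k IH] kn lk hs.
have eL0 : 0 <= eta * L by rewrite mulr_ge0 // ltW.
have eG0 : 0 <= eta * G by rewrite mulr_ge0.
have k0 : (0 : R) <= k%:R by [].
pose i := Ordinal kn; rewrite !(rrpathS _ i) /=.
have [_ b] := rrpath_bound s (ltnW kn); have [_ b'] := rrpath_bound s' (ltnW kn).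
have [li|li] := eqVneq l i.
  have -> : rrpath s k = rrpath s' k.
    apply: rrpath_eq => [|j jk]; first exact: ltnW.
    apply: hs; first exact: ltnW.
    by rewrite li -val_eqE /= ltn_eqF.
  have -> : rrpath s' k - eta *: g (s i) (rrpath s' k) -
      (rrpath s' k - eta *: g (s' i) (rrpath s' k)) =
      eta *: g (s' i) (rrpath s' k) - eta *: g (s i) (rrpath s' k).
    by apply/rowP => a; rewrite !mxE; ring.
  apply: le_trans (enormB_le _ _) _; rewrite !enormZ ger0_norm //.
  have := ler_wpM2l eta_ge0 (g_bound (s i) b').
  have := ler_wpM2l eta_ge0 (g_bound (s' i) b').
  have : 0 <= 2 * (eta * G) * (2 * (k.+1%:R * (eta * L))).
    by rewrite !mulr_ge0 // ltW.
  lra.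
have lk' : (l < k)%N.
  by move: lk; rewrite ltnS leq_eqVlt => /orP[/eqP e|//]; case/eqP: li; exact: val_inj.
have {}IH := IH (ltnW kn) lk' (fun j jk => hs j (ltnW jk)).
rewrite hs // 1?eq_sym //.
have -> : rrpath s k - eta *: g (s' i) (rrpath s k) -
    (rrpath s' k - eta *: g (s' i) (rrpath s' k)) =
    (rrpath s k - rrpath s' k) - eta *: (g (s' i) (rrpath s k) - g (s' i) (rrpath s' k)).
  by apply/rowP => a; rewrite !mxE; ring.
apply: le_trans (enormB_le _ _) _; rewrite enormZ ger0_norm //.
have h1 := ler_wpM2l eta_ge0 (g_lip (s' i) (rrpath s k) (rrpath s' k)).
have h2 := ler_wpM2l eL0 IH.
have keL : k%:R * (eta * L) <= 1 / 32.
  apply: le_trans small_L; rewrite -mulrA ler_wpM2r //.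
  by rewrite le_natN // ltnW.
have h3 := ler_wpM2l (mulr_ge0 eG0 eL0) keL.
have h4 : 0 <= eta * G * (eta * L) by rewrite mulr_ge0.
by rewrite -(natr1 k); lra.
Qed.

(* Exchanging the positions [j] and [l] of the permutation turns [g (s l)] into
   [g (s j)] and perturbs the rrpath up to time [j] in at most one step. *)
Lemma sampling_bias j :
  enorm (vmean (fun s => g (s j) (rrpath s j)) - vmean (fun s => gbar (rrpath s j))) <=
    17 / 8 * (L * eta * G) * (j%:R / N).
Proof.
have eG0 : 0 <= eta * G by rewrite mulr_ge0.
have eL0 : 0 <= eta * L by rewrite mulr_ge0 // ltW.
have E : vmean (fun s => gbar (rrpath s j)) =
    vmean (fun l => vmean (fun s => g (s j) (rrpath (tperm j l * s)%g j))).
  transitivity (vmean (fun s => vmean (fun l => g (s l) (rrpath s j)))).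
    apply: eq_vmean => s; rewrite /gbar /vmean; congr (_ *: _).
    by rewrite (sum_perm s (fun i => g i (rrpath s j))).
  rewrite vmean_exchange; apply: eq_vmean => l.
  rewrite -(vmean_permM (tperm j l) (fun s => g (s l) (rrpath s j))).
  by apply: eq_vmean => s; rewrite permM tpermR.
rewrite E -{1}[vmean (fun s => g (s j) (rrpath s j))](vmean_cst _ ordT_gt0) -vmeanB.
apply: le_trans (enorm_vmean _) _.
(* For [l >= j] the exchange leaves the first [j] steps untouched. Only [j] of the [n] indices
   contribute, which produces [j%:R / N]; the constant is [17 / 8 = 2 * (1 + 2 / 32)]. *)
have H l : enorm (vmean (fun s => g (s j) (rrpath s j)) -
      vmean (fun s => g (s j) (rrpath (tperm j l * s)%g j))) <=
    if (l < j)%N then 17 / 8 * (L * eta * G) else 0.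
  rewrite -vmeanB; apply: le_trans (enorm_vmean _) _.
  rewrite -[leRHS](mean_cst _ (card_perm_gt0 n)); apply: le_mean => s.
  apply: le_trans (g_lip _ _ _) _.
  case: ifP => lj.
    apply: (@le_trans _ _ (L * (2 * (eta * G) * (1 + 2 * (j%:R * (eta * L)))))).
      rewrite ler_wpM2l ?(ltW L_gt0) //; apply: (rrpath_swap (l := l)) => //.
        exact/ltnW/ltn_ord.
      move=> i ij il; rewrite permM tpermD //; last by rewrite eq_sym.
      by rewrite -val_eqE /= gtn_eqF.
    have jeL : j%:R * (eta * L) <= 1 / 32.
      apply: le_trans small_L; rewrite -mulrA ler_wpM2r //.
      by rewrite le_natN // ltnW.
    have := ler_wpM2l (mulr_ge0 (ltW L_gt0) eG0) jeL; lra.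
  rewrite (rrpath_eq (s' := (tperm j l * s)%g)) ?subrr ?enorm0 ?mulr0 //.
    exact/ltnW/ltn_ord.
  move=> i ij; rewrite permM tpermD //; first by rewrite -val_eqE /= gtn_eqF.
  by apply: contraFneq lj => ->.
apply: le_trans (le_mean H) _.
rewrite /mean card_ord -big_mkcond (@sum_ord_lt_cst n) //; last exact/ltnW/ltn_ord.
by rewrite le_eqVlt; apply/orP; left; apply/eqP; ring.
Qed.

(** The sampling bias and the Taylor remainder, each per unit of [j]; [6 / 5] is [1 / 2] times the
    [12 / 5] of [mean_sqr_delta]. *)
Let kappa : R := 17 / 8 * (L * eta * G) / N + 6 / 5 * rho * (eta * G) ^+ 2.

(** The mean of [g (s j) (gd j)] is [gbar (gd j)]. Linearizing at this deterministic point lets the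
    mean pass through the matrix, so the first-order term sees only the mean deviation. *)
Lemma drift_bias j : enorm (vmean (fun s => drift s j)) <=
  j%:R * kappa + L * enorm (vmean (fun s => delta s j)).
Proof.
have -> : vmean (fun s => drift s j) =
    (vmean (fun s => g (s j) (rrpath s j)) - vmean (fun s => gbar (rrpath s j))) +
    (vmean (fun s => gbar (rrpath s j) - gbar (gd j) - delta s j *m A (gd j)) +
     vmean (fun s => delta s j) *m A (gd j)).
  rewrite [LHS]vmeanB (vmean_perm_at j (fun i => g i (gd j))) -/(gbar _).
  rewrite (vmeanB (fun s => gbar (rrpath s j) - gbar (gd j))) vmean_mulmx.
  rewrite (vmeanB (fun s => gbar (rrpath s j))) (vmean_cst _ (card_perm_gt0 n)).
  by rewrite subrK addrA subrK.
apply: le_trans (enormD_le _ _) _.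
apply: (@le_trans _ _ (17 / 8 * (L * eta * G) * (j%:R / N) +
  (6 / 5 * rho * (eta * G) ^+ 2 * j%:R + L * enorm (vmean (fun s => delta s j))))).
  apply: lerD (sampling_bias j) _; apply: le_trans (enormD_le _ _) _.
  apply: lerD (A_bound _ _); apply: le_trans (enorm_vmean _) _.
  apply: (@le_trans _ _ (mean (fun s => rho / 2 * enorm (delta s j) ^+ 2))).
    by apply: le_mean => s; exact: gbar_taylor.
  rewrite meanZ; have hj := mean_sqr_delta (ltnW (ltn_ord j)).
  have := ler_wpM2l rho_ge0 hj; lra.
by rewrite /kappa le_eqVlt; apply/orP; left; apply/eqP; ring.
Qed.

Let kappa_ge0 : 0 <= kappa.
Proof.
have L0 := ltW L_gt0.
by rewrite addr_ge0 // !mulr_ge0 ?invr_ge0 // sqr_ge0.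
Qed.

(** The noise has mean zero, so only the drift remains. The induction closes because
    [1 / 2 + (33 / 64) / 96 <= 33 / 64]. *)
Lemma delta_bias k : (k <= n)%N ->
  enorm (vmean (fun s => delta s k)) <= 33 / 64 * (eta * kappa) * k%:R ^+ 2.
Proof.
elim/ltn_ind: k => k IH kn.
have k0 : (0 : R) <= k%:R by [].
have -> : vmean (fun s => delta s k) =
    - (eta *: \sum_(j < n | (j < k)%N) vmean (fun s => drift s j)).
  rewrite -[in RHS]vmean_sum -vmeanZ -vmeanN.
  transitivity (vmean (fun s => - (eta *: \sum_(j < n | (j < k)%N) noise j (s j)) +
     - (eta *: \sum_(j < n | (j < k)%N) drift s j))).
    by apply: eq_vmean => s; rewrite delta_sum // scalerDr opprD.
  rewrite vmeanD [X in X + _](_ : _ = 0) ?add0r //.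
  rewrite vmeanN vmeanZ vmean_sum big1 ?scaler0 ?oppr0 // => j _.
  by rewrite vmean_perm_at /vmean sum_centered scaler0.
rewrite enormN enormZ ger0_norm //.
set c := 33 / 64 * (eta * kappa).
have c0 : 0 <= c by rewrite !mulr_ge0.
apply: (@le_trans _ _ (eta * \sum_(j < n | (j < k)%N)
    (j%:R * kappa + L * (c * j%:R ^+ 2)))).
  rewrite ler_wpM2l //; apply: le_trans (enorm_sum_le _ _ _) _.
  apply: ler_sum => j jk; apply: le_trans (drift_bias j) _.
  rewrite lerD2l ler_wpM2l ?(ltW L_gt0) // IH //.
  exact: leq_trans (ltnW jk) kn.
rewrite big_split -mulr_suml -!mulr_sumr /=.
apply: (@le_trans _ _ (eta * (k%:R ^+ 2 / 2 * kappa + L * (c * (k%:R ^+ 3 / 3))))).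
  rewrite ler_wpM2l //; apply: lerD; first by rewrite ler_wpM2r // sum_ord_lt_id.
  by rewrite !ler_wpM2l ?(ltW L_gt0) // sum_ord_lt_sqr.
have kL : k%:R * eta * L <= 1 / 32.
  apply: le_trans small_L.
  by rewrite ler_wpM2r ?(ltW L_gt0) // ler_wpM2r // le_natN.
have ek0 : 0 <= eta * kappa * k%:R ^+ 2 by rewrite !mulr_ge0 // sqr_ge0.
have := ler_wpM2l ek0 kL; rewrite /c; lra.
Qed.

Lemma epoch_mean_sqr :
  mean (fun s => enorm (rrpath s n - xs) ^+ 2) <=
    (1 - N * eta * mu / 2) * enorm (y - xs) ^+ 2 +
    (32 * N * L ^+ 2 * G ^+ 2 * eta ^+ 3 / mu +
     3 * (N ^+ 3 * eta ^+ 4 * L ^+ 2 * G ^+ 2) +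
     4 / 9 * rho ^+ 2 * G ^+ 4 * N ^+ 3 * eta ^+ 5 / mu).
Proof.
set z := gd n - xs; set b := vmean (fun s => delta s n).
have am0 : 0 < N * eta * mu by rewrite !mulr_gt0.
have -> : mean (fun s => enorm (rrpath s n - xs) ^+ 2) =
    enorm z ^+ 2 + 2 * edot z b + mean (fun s => enorm (delta s n) ^+ 2).
  rewrite /b edot_vmean -meanZ -[enorm z ^+ 2](mean_cst _ (card_perm_gt0 n)) -!meanD.
  apply: eq_mean => s; rewrite -sqr_enormD; congr (enorm _ ^+ 2).
  by apply/rowP => a; rewrite /z /delta !mxE; ring.
(* Chosen so that [7 / 5 - 19 / 10 = - 1 / 2]: Young's inequality spends part of the contraction and
   leaves the announced rate. *)
pose c := 7 / 5 * (N * eta * mu).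
have c0 : 0 < c by rewrite mulr_gt0.
have hzb : enorm z ^+ 2 + 2 * edot z b <= (1 + c) * enorm z ^+ 2 + enorm b ^+ 2 / c.
  by have := sqr_enormD_le z b c0; rewrite sqr_enormD; lra.
have hz : (1 + c) * enorm z ^+ 2 <= (1 - N * eta * mu / 2) * enorm (y - xs) ^+ 2.
  apply: (@le_trans _ _ ((1 + c) * ((1 - 19 / 10 * (N * eta * mu)) *
      enorm (y - xs) ^+ 2))).
    by rewrite ler_wpM2l ?gd_contract // addr_ge0 // ltW.
  rewrite mulrA ler_wpM2r ?sqr_ge0 // /c.
  have := sqr_ge0 (N * eta * mu); lra.
pose p := 561 / 512 * (N * eta ^+ 2 * L * G).
pose q := 99 / 160 * (rho * eta ^+ 3 * G ^+ 2 * N ^+ 2).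
(* The weights are uneven because the target constant for [p] leaves ample room and the one for [q]
   little. *)
have hb : enorm b ^+ 2 <= 5 * p ^+ 2 + 5 / 4 * q ^+ 2.
  have hpq : enorm b <= p + q.
    apply: le_trans (delta_bias (leqnn n)) _; rewrite -/N /kappa /p /q.
    rewrite le_eqVlt; apply/orP; left; apply/eqP.
    by field; rewrite gt_eqF.
  apply: (@le_trans _ _ ((p + q) ^+ 2)).
    by rewrite ler_pXn2r ?nnegrE ?enorm_ge0 // (le_trans (enorm_ge0 _) hpq).
  by have := sqr_ge0 (4 * p - q); lra.
have hbc : enorm b ^+ 2 / c <= 32 * N * L ^+ 2 * G ^+ 2 * eta ^+ 3 / mu +
    4 / 9 * rho ^+ 2 * G ^+ 4 * N ^+ 3 * eta ^+ 5 / mu.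
  rewrite ler_pdivrMr //; apply: le_trans hb _.
  have -> : (32 * N * L ^+ 2 * G ^+ 2 * eta ^+ 3 / mu +
      4 / 9 * rho ^+ 2 * G ^+ 4 * N ^+ 3 * eta ^+ 5 / mu) * c =
      224 / 5 * (N * eta ^+ 2 * L * G) ^+ 2 +
      28 / 45 * (rho * eta ^+ 3 * G ^+ 2 * N ^+ 2) ^+ 2.
    by rewrite /c; field; rewrite gt_eqF.
  have := sqr_ge0 (N * eta ^+ 2 * L * G).
  have := sqr_ge0 (rho * eta ^+ 3 * G ^+ 2 * N ^+ 2).
  rewrite /p /q !exprMn; lra.
by have := mean_sqr_delta_end; lra.
Qed.

End Epoch.

(** * Iterating over epochs *)

Section Expectation.
Context (R : realType) (n : nat).

Lemma rr_expectation_nil (phi : 0.-tuple 'S_n -> R) :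
  rr_expectation phi = phi [tuple].
Proof.
rewrite /rr_expectation (big_pred1 [tuple]) => [|t]; last by rewrite [t]tuple0 /= eqxx.
by rewrite big_ord0 mul1r.
Qed.

Lemma rr_expectation_cons K (phi : K.+1.-tuple 'S_n -> R) :
  rr_expectation phi =
  mean (fun s => rr_expectation (fun pi : K.-tuple 'S_n => phi [tuple of s :: pi])).
Proof.
rewrite /mean mulr_sumr /rr_expectation.
rewrite (reindex (fun p : 'S_n * K.-tuple 'S_n => [tuple of p.1 :: p.2])) /=; last first.
  exists (fun t => (thead t, [tuple of behead t])) => [[s t] _|t _] /=.
    by congr (_, _); apply: val_inj.
  by rewrite -tuple_eta.
rewrite -(pair_bigA _ (fun (s : 'S_n) (t : K.-tuple 'S_n) => (\prod_(k < K.+1) (#|{: 'S_n}|%:R)^-1) *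
   phi [tuple of s :: t])) /=.
apply: eq_bigr => s _; rewrite mulr_sumr; apply: eq_bigr => t _.
by rewrite big_ord_recl mulrA.
Qed.

Lemma le_rr_expectation K (phi psi : K.-tuple 'S_n -> R) :
  (forall pi, phi pi <= psi pi) -> rr_expectation phi <= rr_expectation psi.
Proof.
move=> h; apply: ler_sum => pi _; rewrite ler_wpM2l //.
by apply: prodr_ge0 => i _; rewrite invr_ge0.
Qed.

Lemma rr_expectationZ K (a : R) (phi : K.-tuple 'S_n -> R) :
  rr_expectation (fun pi => a * phi pi) = a * rr_expectation phi.
Proof. by rewrite mulr_sumr; apply: eq_bigr => pi _; rewrite mulrCA. Qed.

(** Conditioning on the first epoch leaves a deterministic start for the others. Writing the error
    as [(1 - q) * C] makes [C] a fixed point of the recursion, and the invariant [P] holds surely,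
    so the one-epoch bound stays applicable. *)
Lemma rr_expectation_contraction (X : Type) (step : X -> 'S_n -> X)
    (P : X -> Prop) (V : X -> R) (q C : R) K x :
  0 <= q ->
  (forall x s, P x -> P (step x s)) ->
  (forall x, P x -> mean (fun s => V (step x s)) <= q * V x + (1 - q) * C) ->
  P x ->
  rr_expectation (fun pi : K.-tuple 'S_n => V (foldl step x pi)) <=
    q ^+ K * V x + (1 - q ^+ K) * C.
Proof.
move=> q0 hP hV; elim: K x => [|K IH] x Px.
  by rewrite rr_expectation_nil expr0 /=; lra.
rewrite rr_expectation_cons.
apply: (@le_trans _ _ (mean (fun s => q ^+ K * V (step x s) + (1 - q ^+ K) * C))).
  by apply: le_mean => s; apply: IH; exact: hP.
rewrite meanD meanZ mean_cst ?card_perm_gt0 //.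
have := ler_wpM2l (exprn_ge0 K q0) (hV x Px); rewrite exprS; lra.
Qed.

End Expectation.

Lemma ln_nat_ge1 (R : realType) (m : nat) : (3 <= m)%N -> 1 <= ln (m%:R : R).
Proof.
move=> m3; have m0 : 0 < (m%:R : R) by rewrite ltr0n (leq_trans _ m3).
rewrite -ler_expR lnK ?posrE //; apply: (@le_trans _ _ 3); last by rewrite ler_nat.
(* The claim amounts to [e <= 3]; the inequality [1 + x <= exp x] at [- 1 / 6] gives
   [e <= (6 / 5) ^ 6 < 3]. *)
have h : expR (1 : R) = (expR (- (1 / 6)))^-1 ^+ 6.
  by rewrite -expRN opprK -expRM_natl; congr expR; field.
have h2 : 5 / 6 <= expR (- (1 / 6) : R).
  by apply: le_trans (expR_ge1Dx _); lra.
rewrite h; apply: (@le_trans _ _ ((5 / 6)^-1 ^+ 6)); last by lra.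
by rewrite ler_pXn2r ?nnegrE ?invr_ge0 ?expR_ge0 // lef_pV2 ?posrE ?expR_gt0.
Qed.

(** * Application to the problem setting and the prescribed stepsize *)

Section RandomReshuffling.
Context (R : realType) (d n : nat) (f : 'I_n -> 'rV[R]_d -> R).
Context (L mu rho : R) (xs y0 : 'rV[R]_d) (K : nat).
Hypothesis setting : rr_setting f L mu rho xs y0 K.

Let T : R := (n * K)%:R.
Let eta := rr_stepsize n mu K : R.
Let D := Dconst f L xs y0.
Let G := Gconst f L xs y0.
Let F := average f.

Let mu0 : 0 < mu. Proof. exact: rr_mu_gt0 setting. Qed.
Let L0 : 0 < L. Proof. exact: lt_le_trans mu0 (rr_mu_leL setting). Qed.
Let N0 : 0 < (n%:R : R). Proof. by rewrite ltr0n ltnW // (rr_n_ge2 setting). Qed.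
Let K0 : 0 < (K%:R : R). Proof. by rewrite ltr0n (rr_K_ge1 setting). Qed.
Let T0 : 0 < T. Proof. by rewrite /T natrM mulr_gt0. Qed.
Let lnT1 : 1 <= ln T. Proof. exact: ln_nat_ge1 (rr_T_ge3 setting). Qed.
Let lnT0 : 0 < ln T. Proof. exact: lt_le_trans ltr01 lnT1. Qed.
Let eta0 : 0 < eta.
Proof. by rewrite divr_gt0 ?mulr_gt0. Qed.

Lemma gbarE u : vmean (fun i => grad (f i) u) = grad F u.
Proof. by rewrite grad_average ?/vmean ?card_ord //; exact: rr_diff setting. Qed.

Let dF u : differentiable F u. Proof. exact: (rr_twice_diff setting).1. Qed.

Lemma grad_average_min : grad F xs = 0.
Proof. exact: grad_minimizer (dF xs) (rr_minimizer setting). Qed.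

Lemma grad_average_mono u : mu * enorm (u - xs) ^+ 2 <= edot (u - xs) (grad F u).
Proof.
have h1 := strongly_convex_grad xs (rr_strongly_convex setting) (dF u).
have h2 := strongly_convex_grad u (rr_strongly_convex setting) (dF xs).
move: h1 h2; rewrite -/F grad_average_min -(opprB u xs) edotNl enormN.
by rewrite [edot (u - xs) 0]edotC edot0l; lra.
Qed.

Lemma grad_average_lip u v : enorm (grad F u - grad F v) <= L * enorm (u - v).
Proof.
have h := @gbar_lip R d n (fun i => grad (f i)) L (rr_n_ge2 setting) (rr_smooth setting) u v.
by move: h; rewrite !gbarE.
Qed.

(** First-order convexity at [u], then Cauchy-Schwarz and the Lipschitz gradient. *)
Lemma suboptimality_le u : F u - F xs <= L * enorm (u - xs) ^+ 2.
Proof.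
have h1 := strongly_convex_grad xs (rr_strongly_convex setting) (dF u).
have h2 := edot_le (u - xs) (grad F u).
have h3 := grad_average_lip u xs; rewrite grad_average_min subr0 in h3.
move: h1; rewrite -/F -(opprB u xs) edotNl enormN.
have := ler_wpM2l (enorm_ge0 (u - xs)) h3.
have : 0 <= mu / 2 * enorm (u - xs) ^+ 2 by rewrite mulr_ge0 ?sqr_ge0 ?divr_ge0 ?ltW.
by lra.
Qed.

Let Gs0 : 0 <= Gstar f xs. Proof. exact: bigmax_ge_id. Qed.
Let D0 : 0 <= D. Proof. by rewrite le_max enorm_ge0. Qed.
Let Gs_le : Gstar f xs <= 2 * L * D.
Proof.
rewrite mulrC -ler_pdivrMr ?mulr_gt0 // le_max; apply/orP; right; exact: lexx.
Qed.

Let G_ge : 2 * L * D <= G. Proof. by rewrite lerDr. Qed.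
Let G_le : G <= 4 * L * D.
Proof. by rewrite /G /Gconst -/D; move: Gs_le; lra. Qed.

Let grad_bound i u : enorm (u - xs) <= 2 * D -> enorm (grad (f i) u) <= G.
Proof.
move=> hu; rewrite -[grad (f i) u](subrK (grad (f i) xs)).
apply: le_trans (enormD_le _ _) _; rewrite addrC /G /Gconst; apply: lerD.
  exact: (le_bigmax _ (fun i => enorm (grad (f i) xs))).
apply: le_trans (rr_smooth setting _ _ _) _.
by rewrite [2 * L]mulrC -mulrA ler_wpM2l // ltW.
Qed.

Let small_step : n%:R * eta * L ^+ 2 <= mu / 32.
Proof.
have := rr_K_large setting; rewrite -/T => h.
have -> : n%:R * eta * L ^+ 2 = 4 * L ^+ 2 * ln T / (mu * K%:R).
  rewrite /eta /rr_stepsize -/T {2}/T natrM.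
  by field; rewrite !gt_eqF.
rewrite ler_pdivrMr ?mulr_gt0 //.
have -> : 4 * L ^+ 2 * ln T = mu ^+ 2 / 32 * (128 * (L ^+ 2 / mu ^+ 2) * ln T).
  by field; rewrite gt_eqF.
have := ler_wpM2l (_ : 0 <= mu ^+ 2 / 32) h.
by rewrite divr_ge0 ?sqr_ge0 // => /(_ isT); lra.
Qed.

Lemma rr_epochE y s : rr_epoch f eta y s =
  foldl (fun x i => x - eta *: grad (f (s i)) x) y (take n (enum 'I_n)).
Proof. by rewrite take_oversize // size_enum_ord. Qed.

Lemma rr_epoch_ball y s : enorm (y - xs) <= D -> enorm (rr_epoch f eta y s - xs) <= D.
Proof.
move=> hy; rewrite rr_epochE.
apply: (epoch_ball (g := fun i => grad (f i)) (mu := mu) (L := L) (G := G)) => //.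
- exact: rr_n_ge2 setting.
- exact: rr_mu_leL setting.
- exact: rr_smooth setting.
- by move=> u; rewrite gbarE; exact: grad_average_mono.
- by rewrite gbarE grad_average_min.
Qed.

Lemma rr_epoch_mean_sqr y : enorm (y - xs) <= D ->
  mean (fun s => enorm (rr_epoch f eta y s - xs) ^+ 2) <=
    (1 - n%:R * eta * mu / 2) * enorm (y - xs) ^+ 2 +
    (32 * n%:R * L ^+ 2 * G ^+ 2 * eta ^+ 3 / mu +
     3 * (n%:R ^+ 3 * eta ^+ 4 * L ^+ 2 * G ^+ 2) +
     4 / 9 * rho ^+ 2 * G ^+ 4 * n%:R ^+ 3 * eta ^+ 5 / mu).
Proof.
move=> hy; rewrite (@eq_mean _ _ _ (fun s : 'S_n => enorm (foldl
    (fun x i => x - eta *: grad (f (s i)) x) y (take n (enum 'I_n)) - xs) ^+ 2)); last first.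
  by move=> s; rewrite rr_epochE.
(* The epoch estimate is applied with the absolute value of [rho], which is nonnegative and has the
   same square. *)
rewrite -[rho ^+ 2]real_normK ?num_real //.
apply: (epoch_mean_sqr (g := fun i => grad (f i)) (A := hess F) (D := D)) => //.
- exact: rr_n_ge2 setting.
- exact: rr_mu_leL setting.
- exact: rr_smooth setting.
- by move=> u; rewrite gbarE; exact: grad_average_mono.
- by rewrite gbarE grad_average_min.
- move=> u v; apply: (jacobian_bound (ltW L0) (rr_twice_diff setting).2).
  exact: grad_average_lip.
- move=> u v; rewrite !gbarE.
  apply: (jacobian_taylor (ltW L0) (rr_twice_diff setting).2 grad_average_lip).
  exact: rr_hess_lipschitz setting.
Qed.

Let alpha : R := n%:R * eta * mu / 2.

Let alphaE : K%:R * alpha = 2 * ln T.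
Proof.
rewrite /alpha /eta /rr_stepsize -/T {2}/T natrM.
by field; rewrite !gt_eqF.
Qed.

Let alpha0 : 0 < alpha.
Proof. by rewrite divr_gt0 //; exact: mulr_gt0 (mulr_gt0 N0 eta0) mu0. Qed.

Let alpha_le1 : alpha <= 1.
Proof.
have h1 : n%:R * eta * mu ^+ 2 <= n%:R * eta * L ^+ 2.
  apply: ler_wpM2l; first by apply: mulr_ge0; exact: ltW.
  by rewrite ler_pXn2r ?nnegrE ?(ltW mu0) ?(ltW L0) // (rr_mu_leL setting).
have h2 := le_trans h1 small_step.
have : n%:R * eta * mu <= 1 / 32.
  rewrite -(ler_pM2r mu0) (_ : n%:R * eta * mu * mu = n%:R * eta * mu ^+ 2); last by ring.
  lra.
by rewrite /alpha; lra.
Qed.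

Let contraction : (1 - alpha) ^+ K <= (T ^+ 2)^-1.
Proof.
(* The stepsize is tuned so that [K * alpha = 2 * ln T]; then [1 - alpha <= exp (- alpha)] is raised
   to the power [K]. *)
have e : (T ^+ 2)^-1 = expR (- alpha) ^+ K.
  rewrite -expRM_natl mulrN alphaE expRN; congr (_^-1).
  by rewrite (expRM_natl 2) lnK ?posrE.
rewrite e ler_pXn2r ?nnegrE ?expR_ge0 ?subr_ge0 //; first exact: expR_ge1Dx.
exact: rr_K_ge1 setting.
Qed.

Lemma rr_mean_sqr :
  rr_expectation (fun pi : K.-tuple 'S_n =>
      enorm (rr_iterate f eta y0 pi - xs) ^+ 2)
    <= D ^+ 2 / T ^+ 2
       + 1024 * L ^+ 2 * G ^+ 2 * ln T ^+ 2 / (mu ^+ 4 * T ^+ 2)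
       + 384 * L ^+ 2 * G ^+ 2 * n%:R ^+ 2 * ln T ^+ 3 / (mu ^+ 4 * T ^+ 3)
       + 2048 * rho ^+ 2 * G ^+ 4 * n%:R ^+ 2 * ln T ^+ 4
           / (9 * mu ^+ 6 * T ^+ 4).
Proof.
pose B := 32 * n%:R * L ^+ 2 * G ^+ 2 * eta ^+ 3 / mu +
     3 * (n%:R ^+ 3 * eta ^+ 4 * L ^+ 2 * G ^+ 2) +
     4 / 9 * rho ^+ 2 * G ^+ 4 * n%:R ^+ 3 * eta ^+ 5 / mu.
have q0 : 0 <= 1 - alpha by rewrite subr_ge0.
(* The fixed point of the recursion is exactly the last three terms of the bound. *)
have hC : B / alpha = 1024 * L ^+ 2 * G ^+ 2 * ln T ^+ 2 / (mu ^+ 4 * T ^+ 2)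
       + 384 * L ^+ 2 * G ^+ 2 * n%:R ^+ 2 * ln T ^+ 3 / (mu ^+ 4 * T ^+ 3)
       + 2048 * rho ^+ 2 * G ^+ 4 * n%:R ^+ 2 * ln T ^+ 4
           / (9 * mu ^+ 6 * T ^+ 4).
  rewrite /B /alpha /eta /rr_stepsize -/T.
  by field; rewrite !gt_eqF.
have G0 : 0 <= G.
  by apply: le_trans G_ge; rewrite !mulr_ge0 ?(ltW L0).
have B0 : 0 <= B.
  rewrite /B; move: (eta) (G) (ltW eta0) (ltW mu0) (ltW L0) G0 => e g e0 m0 l0 g0.
  move: (rho ^+ 2) (sqr_ge0 rho) => r r0.
  by rewrite !addr_ge0 ?divr_ge0 // !mulr_ge0 // ?exprn_ge0.
have C0 : 0 <= B / alpha by rewrite divr_ge0 // ltW.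
have step y s : enorm (y - xs) <= D -> enorm (rr_epoch f eta y s - xs) <= D.
  exact: rr_epoch_ball.
have mstep y : enorm (y - xs) <= D ->
    mean (fun s => enorm (rr_epoch f eta y s - xs) ^+ 2) <=
      (1 - alpha) * enorm (y - xs) ^+ 2 + (1 - (1 - alpha)) * (B / alpha).
  move=> hy; have -> : (1 - (1 - alpha)) * (B / alpha) = B.
    by field; rewrite gt_eqF.
  exact: rr_epoch_mean_sqr.
have y0D : enorm (y0 - xs) <= D by rewrite le_max lexx.
have := rr_expectation_contraction K q0 step mstep y0D.
move/le_trans; apply; rewrite -!addrA [leRHS](_ : _ = D ^+ 2 / T ^+ 2 + B / alpha); last first.
  by rewrite hC !addrA.
apply: lerD.
  rewrite mulrC; apply: ler_pM => //; rewrite ?sqr_ge0 ?exprn_ge0 //.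
  by rewrite ler_pXn2r ?nnegrE ?enorm_ge0.
by rewrite ler_piMl // gerBl exprn_ge0.
Qed.

Lemma rr_mean_suboptimality :
  rr_expectation (fun pi : K.-tuple 'S_n =>
      average f (rr_iterate f eta y0 pi) - average f xs)
  <= L * (D ^+ 2 + 1024 * L ^+ 2 * G ^+ 2 / mu ^+ 4 +
          384 * L ^+ 2 * G ^+ 2 / mu ^+ 4 +
          2048 * rho ^+ 2 * G ^+ 4 / (9 * mu ^+ 6)) * ln T ^+ 4
     * (1 / (n%:R * K%:R) ^+ 2 + 1 / (n%:R * K%:R ^+ 3)).
Proof.
apply: le_trans (le_rr_expectation (fun pi => suboptimality_le _)) _.
rewrite rr_expectationZ -2!mulrA ler_wpM2l ?(ltW L0) //.
apply: le_trans rr_mean_sqr _.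
have TE : T = n%:R * K%:R by rewrite /T natrM.
set a := 1 / (n%:R * K%:R) ^+ 2; set b := 1 / (n%:R * K%:R ^+ 3).
have a0 : 0 <= a by rewrite divr_ge0 // sqr_ge0.
have b0 : 0 <= b by rewrite divr_ge0 // mulr_ge0 // exprn_ge0.
have K1 : 1 <= (K%:R : R) by rewrite ler1n (rr_K_ge1 setting).
have l0 := ltW lnT0.
have lX k : (k <= 4)%N -> ln T ^+ k <= ln T ^+ 4 by move=> k4; exact: ler_weXn2l.
have LG (c : R) : 0 <= c -> 0 <= c * L ^+ 2 * G ^+ 2 / mu ^+ 4.
  move=> c0; apply: divr_ge0; last exact/exprn_ge0/ltW.
  exact: mulr_ge0 (mulr_ge0 c0 (sqr_ge0 L)) (sqr_ge0 G).
have RG (c : R) : 0 <= c -> 0 <= c * rho ^+ 2 * G ^+ 4 / (9 * mu ^+ 6).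
  move=> c0; apply: divr_ge0; last by apply: mulr_ge0 => //; exact/exprn_ge0/ltW.
  exact: mulr_ge0 (mulr_ge0 c0 (sqr_ge0 rho)) (@exprn_even_ge0 _ 4 G isT).
rewrite mulrA [leRHS](_ : _ = D ^+ 2 * ln T ^+ 4 * (a + b) +
  1024 * L ^+ 2 * G ^+ 2 / mu ^+ 4 * ln T ^+ 4 * (a + b) +
  384 * L ^+ 2 * G ^+ 2 / mu ^+ 4 * ln T ^+ 4 * (a + b) +
  2048 * rho ^+ 2 * G ^+ 4 / (9 * mu ^+ 6) * ln T ^+ 4 * (a + b)); last by ring.
(* Each of the four terms is a constant times a power of [ln T >= 1] times [a], [a], [b] or
   [a / K ^ 2] respectively; raising every power to 4 makes them uniform. *)
have key (c t u : R) k : 0 <= c -> (k <= 4)%N -> 0 <= u -> u <= a + b ->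
    t = c * ln T ^+ k * u -> t <= c * ln T ^+ 4 * (a + b).
  move=> c0 k4 u0 ub ->; apply: ler_pM => //; first by rewrite mulr_ge0 // exprn_ge0.
  by rewrite ler_wpM2l // lX.
have ab1 : a <= a + b by rewrite lerDl.
have ab2 : b <= a + b by rewrite lerDr.
have aK0 : 0 <= a / K%:R ^+ 2 by rewrite divr_ge0 // sqr_ge0.
have aK : a / K%:R ^+ 2 <= a + b.
  by apply: le_trans ab1; rewrite ler_piMr // invf_le1 ?exprn_gt0 // exprn_ege1.
have Nn0 : n%:R != 0 :> R by rewrite gt_eqF.
have Kn0 : K%:R != 0 :> R by rewrite gt_eqF.
have mn0 : mu != 0 by rewrite gt_eqF.
apply: lerD; first apply: lerD; first apply: lerD.
- apply: (key _ _ a 0%N (sqr_ge0 D) isT a0 ab1).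
  by rewrite /a TE; field; rewrite Nn0 Kn0.
- apply: (key _ _ a 2%N (LG _ (ler0n R 1024%N)) isT a0 ab1).
  by rewrite /a TE; field; rewrite mn0 Nn0 Kn0.
- apply: (key _ _ b 3%N (LG _ (ler0n R 384%N)) isT b0 ab2).
  by rewrite /b TE; field; rewrite mn0 Nn0 Kn0.
- apply: (key _ _ (a / K%:R ^+ 2) 4%N (RG _ (ler0n R 2048%N)) isT aK0 aK).
  by rewrite /a TE; field; rewrite mn0 Nn0 Kn0.
Qed.

End RandomReshuffling.

Theorem corollary3p5 (R : realType) :
  (forall (d n : nat) (f : 'I_n -> 'rV[R]_d -> R) (L mu rho : R)
      (xs y0 : 'rV[R]_d) (K : nat),
    rr_setting f L mu rho xs y0 K ->
    let T : R := (n * K)%:R in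
    let eta := rr_stepsize n mu K in
    let D := Dconst f L xs y0 in
    let G := Gconst f L xs y0 in
    rr_expectation (fun pi : K.-tuple 'S_n =>
        enorm (rr_iterate f eta y0 pi - xs) ^+ 2)
      <= D ^+ 2 / T ^+ 2
         + 1024 * L ^+ 2 * G ^+ 2 * ln T ^+ 2 / (mu ^+ 4 * T ^+ 2)
         + 384 * L ^+ 2 * G ^+ 2 * n%:R ^+ 2 * ln T ^+ 3 / (mu ^+ 4 * T ^+ 3)
         + 2048 * rho ^+ 2 * G ^+ 4 * n%:R ^+ 2 * ln T ^+ 4
             / (9 * mu ^+ 6 * T ^+ 4))
  /\
  (exists (p : nat) (C : R -> R -> R -> R -> R -> R),
    forall (d n : nat) (f : 'I_n -> 'rV[R]_d -> R) (L mu rho : R)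
      (xs y0 : 'rV[R]_d) (K : nat),
    rr_setting f L mu rho xs y0 K ->
    let T : R := (n * K)%:R in
    let eta := rr_stepsize n mu K in
    let D := Dconst f L xs y0 in
    let G := Gconst f L xs y0 in
    rr_expectation (fun pi : K.-tuple 'S_n =>
        average f (rr_iterate f eta y0 pi) - average f xs)
      <= C L mu rho G D * ln T ^+ p
         * (1 / (n%:R * K%:R) ^+ 2 + 1 / (n%:R * K%:R ^+ 3))).
Proof.
split; first by move=> d n f L mu rho xs y0 K setting; exact: rr_mean_sqr.
(* The exponent is the largest power of the logarithm among the four terms; the constant is [L]
   times the sum of their coefficients. *)
exists 4%N, (fun L mu rho G D => L * (D ^+ 2 + 1024 * L ^+ 2 * G ^+ 2 / mu ^+ 4 +
  384 * L ^+ 2 * G ^+ 2 / mu ^+ 4 + 2048 * rho ^+ 2 * G ^+ 4 / (9 * mu ^+ 6))).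
by move=> d n f L mu rho xs y0 K setting; exact: rr_mean_suboptimality.
Qed.
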